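(* Let $G$ be a group, let $R$ be a unital commutative ring, and let $V$ be a representation of $G$ over $R$ which is free and finitely generated as an $R$-module. Let $n \in \mathbb{N}$ and let $\lambda$ be a partition of $n$. Fix a totally ordered $R$-basis $\mathcal{B}$ of $V$. Then: (a) There is a short exact sequence of $RG$-modules $$0 \longrightarrow \mathsf{DG}^{\lambda}(V) \longrightarrow \mathrm{Sym}_\lambda(V) \xrightarrow{\ \Lambda\ } \mathsf{copolytab}^\lambda(V) \longrightarrow 0,$$ where the first map is the inclusion of the space of dual Garnir relations and $\Lambda$ is the restriction to $\mathrm{Sym}_\lambda(V)$ of the projection map $V^{\otimes n} \to \bigwedge^{\lambda'}(V)$, which sends the row symmetrisation $\mathrm{rsym}(t)$ labelled by a tableau $t$ to the copolytabloid $\mathrm{c}(t)$ labelled by $t$. (b) The space $\mathsf{copolytab}^\lambda(V)$ has $R$-basis consisting of the copolytabloids labelled by semistandard tableaux, that is, $\{\mathrm{c}(s) \mid s \in \mathrm{SSYT}_{\mathcal{B}}(\lambda)\}$.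
   Context: Partitions and tableaux. A partition $\lambda$ of $n$ is a weakly decreasing finite sequence of positive integers with sum $n=|\lambda|$; put $\lambda_i=0$ for $i$ larger than the number of parts. The conjugate $\lambda'$ is $\lambda'_i=|\{j\ge 1 : \lambda_j\ge i\}|$. The Young diagram is $[\lambda]=\{(i,j): 1\le i\le \lambda'_1,\ 1\le j\le\lambda_i\}$; its elements are boxes; $\mathrm{row}_i(\lambda)$ and $\mathrm{col}_j(\lambda)$ are the sets of boxes $(i,\cdot)$ and $(\cdot,j)$ respectively. A tableau is a function $t:[\lambda]\to\mathcal{B}$. It is semistandard if its entries weakly increase along rows (left to right, i.e. as $j$ increases) and strictly increase down columns (as $i$ increases); $\mathrm{SSYT}_{\mathcal{B}}(\lambda)$ is the set of semistandard tableaux. Identification with tensors. The free $R$-module on the set of tableaux is identified with $V^{\otimes n}$ (tensor factors indexed by the boxes of $[\lambda]$, a tableau being the pure tensor of its entries), with diagonal $G$-action. Place permutations. For a set $X$, $S_X$ is its group of permutations, written on the right. $S_{[\lambda]}$ acts on tableaux on the right by $(t\cdot\sigma)(b)=t(b\sigma^{-1})$. Let $\mathrm{RPP}(\lambda)=\prod_i S_{\mathrm{row}_i(\lambda)}\le S_{[\lambda]}$. Let $\mathrm{rstab}(t)$ be the stabiliser of $t$ in $\mathrm{RPP}(\lambda)$. Two tableaux $t,u$ are row equivalent, $t\sim_{\mathrm r}u$, if for every $i$ they have the same multiset of entries in row $i$. For a subgroup $I$ of a group $S$, $I\backslash S$ denotes a set of representatives of the right cosets $I\sigma$. Symmetric tensors.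 $\mathrm{Sym}_r V\subseteq V^{\otimes r}$ is the submodule of symmetric tensors, and $\mathrm{Sym}_\lambda(V)=\bigotimes_{i=1}^{\lambda_1'}\mathrm{Sym}_{\lambda_i}V\subseteq V^{\otimes n}$ (the $i$th factor occupying the boxes of row $i$). The row symmetrisation of a tableau $t$ is $$\mathrm{rsym}(t)=\sum_{\tau\in \mathrm{rstab}(t)\backslash\mathrm{RPP}(\lambda)} t\cdot\tau\ \in \mathrm{Sym}_\lambda(V).$$ Exterior powers. $\bigwedge^{\lambda'}(V)=\bigotimes_{j=1}^{\lambda_1}\bigwedge^{\lambda'_j}V$. The projection $V^{\otimes n}\to\bigwedge^{\lambda'}(V)$ sends a tableau $t$ to its column tabloid $|t|=\bigotimes_{j}\big(t(1,j)\wedge t(2,j)\wedge\cdots\wedge t(\lambda'_j,j)\big)$. Copolytabloids. The copolytabloid of a tableau $t$ is $\mathrm{c}(t)=\Lambda(\mathrm{rsym}(t))=\sum_{\tau\in\mathrm{rstab}(t)\backslash\mathrm{RPP}(\lambda)}|t\cdot\tau|\in\bigwedge^{\lambda'}(V)$. $\mathsf{copolytab}^\lambda(V)\subseteq\bigwedge^{\lambda'}(V)$ is the $R$-span of all copolytabloids. Dual Garnir relations. Let $t$ be a tableau, $1\le i<i'\le\lambda'_1$, and $A\subseteq\mathrm{row}_i(\lambda)$, $B\subseteq\mathrm{row}_{i'}(\lambda)$ with $|A|+|B|>\lambda_i$. Let $\mathcal{T}=\{t\cdot\tau : \tau\in S_{A\sqcup B}\}$ (a set, not a multiset), and let $\mathcal{T}/{\sim_{\mathrm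 r}}$ be a set of representatives, chosen in $\mathcal{T}$, for the row equivalence classes of elements of $\mathcal{T}$. The dual Garnir relation labelled by $(t,A,B)$ is $$D_{(t,A,B)}=\sum_{u\in\mathcal{T}/{\sim_{\mathrm r}}}\big|\,\mathrm{rstab}(u):\mathrm{rstab}(u)\cap(S_{A\sqcup B}\times S_{[\lambda]\setminus (A\sqcup B)})\,\big|\ \mathrm{rsym}(u)\in\mathrm{Sym}_\lambda(V),$$ where $|X:Y|$ is the index of the subgroup $Y$ in $X$ (this does not depend on the choice of representatives). $\mathsf{DG}^\lambda(V)\subseteq\mathrm{Sym}_\lambda(V)$ is the $R$-span of all dual Garnir relations. *)

(* Defs.v *)
From HB Require Import structures.
From mathcomp Require Import all_boot all_order all_fingroup all_algebra.
From mathcomp Require Import boolp classical_sets.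

Set Implicit Arguments.
Unset Strict Implicit.
Unset Printing Implicit Defensive.

Import Order.TTheory GRing.Theory.

Local Open Scope ring_scope.
Local Open Scope quotient_scope.

(* Rings are [comPzRingType]: the zero ring is not excluded.  Submodules of a *)
(* module [M] are predicates [M -> Prop].                                     *)

Section Modules.

Variables (R : comPzRingType) (M : lmodType R).

Definition rspan (S : M -> Prop) (x : M) : Prop :=
  exists2 s : seq (R * M),
    (forall p, p \in s -> S p.2) & x = \sum_(p <- s) p.1 *: p.2.

Definition lincomb (I : finType) (f : I -> M) (c : {ffun I -> R}) : M :=
  \sum_i c i *: f i.

Definition is_basis (P : M -> Prop) (I : finType) (f : I -> M) : Prop :=
  (forall x, P x <-> exists c, x = lincomb f c) /\
  (forall c, lincomb f c = 0 -> forall i, c i = 0).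

(* A junk value (0) is returned when [x] is not a combination of [f]. *)
Definition bcoord (I : finType) (f : I -> M) (x : M) : {ffun I -> R} :=
  xget 0 (fun c => x = lincomb f c).

Section Quotient.

Variable S : M -> Prop.

Definition in_rspan : {pred M} := fun x => `[< rspan S x >].

Lemma rspan_lin a x y : rspan S x -> rspan S y -> rspan S (a *: x + y).
Proof.
move=> [s Ss ->] [s' Ss' ->]; exists ([seq (a * p.1, p.2) | p <- s] ++ s').
  by move=> p; rewrite mem_cat => /orP[/mapP[q qs ->] /=|]; [apply: Ss|apply: Ss'].
rewrite big_cat big_map scaler_sumr /=; congr (_ + _).
by apply: eq_bigr => p _; rewrite scalerA.
Qed.

Lemma rspan0 : rspan S 0.
Proof. by exists [::] => [p|]; rewrite ?in_nil // big_nil. Qed.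

Fact in_rspan_zmod : zmod_closed in_rspan.
Proof.
split; first by apply/asboolP; exact: rspan0.
move=> x y /asboolP Sx /asboolP Sy; apply/asboolP.
by rewrite addrC -scaleN1r; exact: rspan_lin.
Qed.

HB.instance Definition _ := GRing.isZmodClosed.Build M in_rspan in_rspan_zmod.

Definition quotm : Type := {ideal_quot in_rspan}.

HB.instance Definition _ := GRing.Zmodule.on quotm.

Definition to_quotm (x : M) : quotm := \pi_({ideal_quot in_rspan}) x.

Definition quotm_scale (a : R) (q : quotm) : quotm :=
  to_quotm (a *: generic_quotient.repr (q : {ideal_quot in_rspan})).

Lemma to_quotm_eq x y : to_quotm x = to_quotm y <-> rspan S (x - y).
Proof.
split=> [/eqP|Sxy].
  by rewrite /to_quotm -Quotient.idealrBE => /asboolP.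
by apply/eqP; rewrite /to_quotm -Quotient.idealrBE; apply/asboolP.
Qed.

Lemma to_quotmD : {morph to_quotm : x y / x + y}.
Proof. by move=> x y; rewrite /to_quotm raddfD. Qed.

Lemma quotm_scale_pi a x : quotm_scale a (to_quotm x) = to_quotm (a *: x).
Proof.
apply/to_quotm_eq; rewrite -scalerBr -[_ *: _]addr0.
apply: rspan_lin rspan0; apply/to_quotm_eq; exact: reprK.
Qed.

Lemma to_quotm_surj q : exists x, q = to_quotm x.
Proof.
by exists (generic_quotient.repr (q : {ideal_quot in_rspan})); rewrite /to_quotm reprK.
Qed.

Fact quotm_scaleA a b q : quotm_scale a (quotm_scale b q) = quotm_scale (a * b) q.
Proof.
by have [x ->] := to_quotm_surj q; rewrite !quotm_scale_pi scalerA.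
Qed.
Fact quotm_scale1 : left_id 1 quotm_scale.
Proof.
by move=> q; have [x ->] := to_quotm_surj q; rewrite quotm_scale_pi scale1r.
Qed.
Fact quotm_scaleDr : right_distributive quotm_scale +%R.
Proof.
move=> a p q; have [x ->] := to_quotm_surj p; have [y ->] := to_quotm_surj q.
by rewrite -to_quotmD !quotm_scale_pi -to_quotmD scalerDr.
Qed.
Fact quotm_scaleDl q : {morph quotm_scale^~ q : a b / a + b}.
Proof.
move=> a b; have [x ->] := to_quotm_surj q.
by rewrite !quotm_scale_pi -to_quotmD scalerDl.
Qed.

HB.instance Definition _ := GRing.Zmodule_isLmodule.Build R quotm
  quotm_scaleA quotm_scale1 quotm_scaleDr quotm_scaleDl.

End Quotient.

End Modules.

Section Representations.

Variables (G : groupType) (R : comPzRingType).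

Record representation (M : lmodType R) (rho : G -> M -> M) : Prop := {
  rep_linear : forall g a x y, rho g (a *: x + y) = a *: rho g x + rho g y;
  rep_1 : forall x, rho 1%g x = x;
  rep_M : forall g h x, rho (g * h)%g x = rho g (rho h x) }.

Record subrep (M : lmodType R) (rho : G -> M -> M) (P : M -> Prop) : Prop := {
  subrep_0 : P 0;
  subrep_lin : forall a x y, P x -> P y -> P (a *: x + y);
  subrep_act : forall g x, P x -> P (rho g x) }.

(* 0 -> K -> S -> Q -> 0 is a short exact sequence of RG-modules, where K and *)
(* S are RG-submodules of M, Q is an RG-submodule of N, the first map is the  *)
(* inclusion and the second one is the restriction of f to S.                 *)
Record short_exact (M N : lmodType R) (rhoM : G -> M -> M) (rhoN : G -> N -> N)
    (K S : M -> Prop) (f : M -> N) (Q : N -> Prop) : Prop := {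
  se_repM : representation rhoM;
  se_repN : representation rhoN;
  se_K : subrep rhoM K;
  se_S : subrep rhoM S;
  se_Q : subrep rhoN Q;
  se_incl : forall x, K x -> S x;
  se_maps : forall x, S x -> Q (f x);
  se_linear : forall a x y, S x -> S y -> f (a *: x + y) = a *: f x + f y;
  se_equivariant : forall g x, S x -> f (rhoM g x) = rhoN g (f x);
  se_exact : forall x, S x -> (f x = 0 <-> K x);
  se_surj : forall y, Q y -> exists2 x, S x & f x = y }.

End Representations.

(* [B] indexes a basis [e] of [V]; the tensor power of [V] with factors       *)
(* indexed by [X] is the free module on the functions [X -> B], such a        *)
(* function [t] standing for the pure tensor of the [e (t b)].                *)
Section Tensors.

Variables (R : comPzRingType) (B X : finType).

Definition tens : Type := {ffun {ffun X -> B} -> R^o}.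

HB.instance Definition _ := GRing.Lmodule.on tens.

Definition pure_tab (t : {ffun X -> B}) : tens := [ffun u => (u == t)%:R].

(* The product of permutations in MathComp is that of maps written on the     *)
(* right: (s1 * s2) b = s2 (s1 b).                                            *)
Definition tact (t : {ffun X -> B}) (s : {perm X}) : {ffun X -> B} :=
  [ffun b => t (s^-1%g b)].

Definition symmetric_tens (x : tens) : Prop :=
  forall (s : {perm X}) t, x (tact t s) = x t.

Variables (V : lmodType R) (e : B -> V).

Definition pure (v : X -> V) : tens :=
  [ffun u : {ffun X -> B} => \prod_b bcoord e (v b) (u b)].

Definition tens_act (G : groupType) (rho : G -> V -> V) (g : G) (x : tens) :
    tens :=
  \sum_t x t *: pure (fun b => rho g (e (t b))).

End Tensors.

Section Partitions.

Definition is_part (n : nat) (la : seq nat) : bool :=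
  [&& sorted geq la, all (leq 1) la & sumn la == n].

(* Rows and columns are numbered from 0. *)
Definition box (la : seq nat) : Type := {i : 'I_(size la) & 'I_(nth 0%N la i)}.

HB.instance Definition _ la := Finite.on (box la).

Definition brow la (b : box la) : 'I_(size la) := tag b.
Definition bcol la (b : box la) : nat := tagged b.

Definition row_boxes la (i : 'I_(size la)) : {set box la} :=
  [set b : box la | brow b == i]%SET.

Definition RPP la : {set {perm box la}} :=
  [set s : {perm box la} | [forall b, brow (s b) == brow b]]%SET.

End Partitions.

Section Tableaux.

Variables (la : seq nat) (d : Order.disp_t) (B : finOrderType d).

Definition tab : Type := {ffun box la -> B}.

HB.instance Definition _ := Finite.on tab.

Implicit Types t u : tab.

Definition semistandard t : bool :=
  [forall b, forall b',
    ((brow b == brow b') && (bcol b <= bcol b')%N ==> (t b <= t b')%O) &&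
    ((bcol b == bcol b') && (brow b < brow b')%N ==> (t b < t b')%O)].

Definition SSYT : Type := {t : tab | semistandard t}.

HB.instance Definition _ := Finite.on SSYT.

Definition row_of t (i : 'I_(size la)) : {ffun 'I_(nth 0%N la i) -> B} :=
  [ffun j => t (Tagged (fun i : 'I_(size la) => 'I_(nth 0%N la i)) j)].

Definition row_equiv t u : bool :=
  [forall i, perm_eq (codom (row_of t i)) (codom (row_of u i))].

Definition rstab t : {set {perm box la}} :=
  [set s in RPP la | tact t s == t]%SET.

Variable R : comPzRingType.

Local Notation tensor := (tens R B (box la)).

(* [Sym_la V] as the image in the tensor power of the tensor product of the   *)
(* [Sym_(la_i) V]: the tensor product of the [x i] has coefficient            *)
(* [\prod_i x i (row i of t)] at [t].                                         *)
Definition Symlambda : tensor -> Prop :=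
  rspan (fun z : tensor =>
    exists2 x : forall i : 'I_(size la), tens R B 'I_(nth 0%N la i),
      (forall i, symmetric_tens (x i))
      & z = [ffun t : tab => \prod_i x i (row_of t i)]).

Definition rsym t : tensor :=
  \sum_(C in rcosets (rstab t) (RPP la)) pure_tab R (tact t (repr C)).

Definition Garnir_orbit t (A C : {set box la}) : {set tab} :=
  [set tact t s | s in Sym (A :|: C)]%SET.

Definition Garnir_reps t (A C : {set box la}) : {set tab} :=
  let T := Garnir_orbit t A C in
  transversal (equivalence_partition row_equiv T) T.

Definition dual_Garnir t (A C : {set box la}) : tensor :=
  \sum_(u in Garnir_reps t A C)
    rsym u *+
      #|rstab u : rstab u :&: (Sym (A :|: C) * Sym (~: (A :|: C)))|%g.

Definition DG : tensor -> Prop :=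
  rspan (fun z : tensor =>
    exists t (i i' : 'I_(size la)) (A C : {set box la}),
      [/\ (i < i')%N, A \subset row_boxes i, C \subset row_boxes i',
          (nth 0 la i < #|A| + #|C|)%N & z = dual_Garnir t A C]).

Variables (V : lmodType R) (e : B -> V).

(* The tensor product over the columns of the exterior powers of [V], as the  *)
(* quotient of the tensor power by the span of the pure tensors with two      *)
(* equal factors in some column.                                              *)
Definition col_repeat (z : tensor) : Prop :=
  exists (v : box la -> V) (b b' : box la),
    [/\ b != b', bcol b = bcol b', v b = v b' & z = pure e v].

Definition ext : Type := quotm col_repeat.

HB.instance Definition _ := GRing.Lmodule.on ext.

Definition to_ext (z : tensor) : ext := to_quotm col_repeat z.

Definition ext_act (G : groupType) (rho : G -> V -> V) (g : G) (q : ext) : ext :=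
  to_ext (tens_act e rho g (generic_quotient.repr (q : {ideal_quot in_rspan col_repeat}))).

Definition col_tabloid t : ext := to_ext (pure_tab R t).

Definition copolytabloid t : ext :=
  \sum_(C in rcosets (rstab t) (RPP la)) col_tabloid (tact t (repr C)).

Definition copolytab : ext -> Prop :=
  rspan (fun q : ext => exists t, q = copolytabloid t).

End Tableaux.

Arguments Symlambda la {d} B R _.
Arguments DG la {d} B R _.
Arguments to_ext {la d B R V} e z.
Arguments ext_act {la d B R V} e {G} rho g q.
Arguments copolytab la {d B R V} e _.

(* Main.v *)
(* Both parts of the theorem come from two facts about the row symmetrisations
   of semistandard tableaux: modulo dual Garnir relations they span Sym_la V,
   and their images under Lambda are linearly independent.

   Dual Garnir relations lie in the kernel of Lambda.  With X = A + B (disjoint),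
   the coefficient of a tableau in D_(t,A,B) counts the cosets of the
   subgroup K of RPP preserving X that carry the tableau into one fixed
   Sym X-stable set W of tableaux; hence D is the sum over these cosets of the
   translates of the sum of W.  Since |A| + |B| exceeds the length of the upper
   row, each translate of X has two boxes in a common column, and swapping them
   is a sign-reversing involution on the translate of W.

   Straightening.  If t has sorted rows and t b' <= t b with b above b' in a
   column, let A be the boxes in the row of b with entries >= t b and B those in
   the row of b' with entries <= t b'.  Then rsym t has coefficient 1 in
   D_(t,A,B), and the other terms have larger dominance, the sum over k and over
   the down-closed sets D of values of the number of entries from D in the
   first k rows.

   Independence.  The alternating sum over the column permutations s of the
   coefficients at w.s factors through the exterior powers.  For w semistandard,
   dominance is strictly smaller at w.s than at w unless s = 1, so these
   functionals are unitriangular on semistandard row symmetrisations.           *)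

Require Import Defs.
From HB Require Import structures.
From mathcomp Require Import all_boot all_order all_fingroup all_algebra.
From mathcomp Require Import boolp classical_sets.

Set Implicit Arguments.
Unset Strict Implicit.
Unset Printing Implicit Defensive.

Import Order.TTheory GRing.Theory.

Local Open Scope ring_scope.

(** * Spans, bases and tensor powers *)

Section Span.

Variables (R : comPzRingType) (M : lmodType R).
Implicit Types S P : M -> Prop.

Lemma rspan_ind S P : P 0 -> (forall a x y, S x -> P y -> P (a *: x + y)) ->
  forall x, rspan S x -> P x.
Proof.
move=> P0 PS x [s Ss ->]; elim: s Ss => [|p s IHs] Ss; first by rewrite big_nil.
rewrite big_cons; apply: PS; first by apply: Ss; rewrite mem_head.
by apply: IHs => q qs; apply: Ss; rewrite in_cons qs orbT.
Qed.

Lemma rspan_gen S x : S x -> rspan S x.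
Proof.
exists [:: (1, x)]; last by rewrite big_seq1 scale1r.
by move=> p; rewrite inE => /eqP->.
Qed.

Lemma rspan_sum S (I : Type) (r : seq I) (Q : pred I) (f : I -> M) :
  (forall i, Q i -> rspan S (f i)) -> rspan S (\sum_(i <- r | Q i) f i).
Proof.
move=> Sf; elim/big_rec: _ => [|i y Qi Sy]; first exact: rspan0.
by rewrite -[f i]scale1r; apply: rspan_lin => //; exact: Sf.
Qed.

Lemma rspanZ S a x : rspan S x -> rspan S (a *: x).
Proof. by move=> Sx; rewrite -[_ *: _]addr0; apply: rspan_lin => //; exact: rspan0. Qed.

Lemma to_quotm_is_linear S : linear (to_quotm S).
Proof. by move=> a x y; rewrite to_quotmD -quotm_scale_pi. Qed.

(* Unqualified, [quotm] is the quotient morphism of [fingroup]. *)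
HB.instance Definition _ S :=
  GRing.isLinear.Build R M (Defs.quotm S) _ (to_quotm S) (to_quotm_is_linear S).

Lemma to_quotm0 S x : to_quotm S x = 0 <-> rspan S x.
Proof. by rewrite -(linear0 (to_quotm S)) to_quotm_eq subr0. Qed.

End Span.

(** Fibres of equal size are matched in enumeration order. This turns equal multiplicities into
    place permutations. *)
Lemma eq_fiber_perm (I : finType) (T : eqType) (f g : I -> T) :
  (forall y, #|[set b | f b == y]| = #|[set b | g b == y]|) ->
  exists s : {perm I}, forall b, g b = f (s b).
Proof.
move=> fg; pose F y := enum [set b | f b == y]; pose H y := enum [set b | g b == y].
have FH y : size (F y) = size (H y) by rewrite -!cardE.
(* The default [b] is never reached: [idx] keeps the index in range. *)
pose s b := nth b (F (g b)) (index b (H (g b))).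
have idx b : (index b (H (g b)) < size (F (g b)))%N.
  by rewrite FH index_mem /H mem_enum inE.
have fs b : f (s b) = g b.
  have := mem_nth b (idx b); rewrite -/(s b).
  by rewrite mem_enum inE => /eqP.
have s_inj : injective s.
  move=> b b' ss'; have gg : g b = g b' by rewrite -!fs ss'.
  move: ss' (idx b') (idx b); rewrite /s gg => + ib' ib.
  rewrite (set_nth_default b) // => /eqP; rewrite nth_uniq ?enum_uniq // => /eqP.
  by move/(index_inj b); apply; rewrite /H mem_enum inE ?gg.
by exists (perm s_inj) => b; rewrite permE fs.
Qed.

Section Basis.

Variables (R : comPzRingType) (V : lmodType R) (B : finType) (e : B -> V).
Hypothesis e_basis : is_basis (fun _ : V => True) e.

Lemma bcoordK v : lincomb e (bcoord e v) = v.
Proof.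
have Hv : exists c, v = lincomb e c by have [H _] := e_basis; apply/H.
by rewrite /bcoord -(xgetPex 0 Hv).
Qed.

Lemma lincomb_inj : injective (lincomb e).
Proof.
move=> c c' cc'; have [_ free_e] := e_basis.
apply/ffunP => b; apply/eqP; rewrite -subr_eq0; apply/eqP.
have := free_e [ffun b => c b - c' b] _ b; rewrite ffunE; apply.
transitivity (lincomb e c - lincomb e c'); last by rewrite cc' subrr.
by rewrite /lincomb -sumrB; apply: eq_bigr => i _; rewrite ffunE scalerBl.
Qed.

Lemma bcoord_lin a v w b :
  bcoord e (a *: v + w) b = a * bcoord e v b + bcoord e w b.
Proof.
suff ->: bcoord e (a *: v + w) = [ffun b => a * bcoord e v b + bcoord e w b].
  by rewrite ffunE.
apply: lincomb_inj; rewrite bcoordK -{1}[v]bcoordK -{1}[w]bcoordK /lincomb.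
rewrite scaler_sumr -big_split; apply: eq_bigr => i _.
by rewrite ffunE scalerDl scalerA.
Qed.

Lemma bcoordD v w b : bcoord e (v + w) b = bcoord e v b + bcoord e w b.
Proof. by rewrite -{1}[v]scale1r bcoord_lin mul1r. Qed.

Lemma bcoord_basis x b : bcoord e (e x) b = (b == x)%:R.
Proof.
suff ->: bcoord e (e x) = [ffun b => (b == x)%:R] by rewrite ffunE.
apply: lincomb_inj; rewrite bcoordK /lincomb (bigD1 x) //= ffunE eqxx scale1r.
by rewrite big1 ?addr0 // => i /negPf ix; rewrite ffunE ix scale0r.
Qed.

Lemma bcoord_sum (I : Type) (r : seq I) (c : I -> R) (f : I -> V) b :
  bcoord e (\sum_(i <- r) c i *: f i) b = \sum_(i <- r) c i * bcoord e (f i) b.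
Proof.
elim: r => [|i r IHr]; last by rewrite !big_cons bcoord_lin IHr.
(* The zero vector has zero coordinates, by linearity at [-1 *: 0 + 0]. *)
rewrite !big_nil; have := bcoord_lin (-1) 0 0 b.
by rewrite scaler0 addr0 mulN1r addNr.
Qed.

(** * Tensor powers and the diagonal action *)

Section Tensor.

Variable X : finType.
Implicit Types (v : X -> V) (t u : {ffun X -> B}) (x y : tens R B X).

Lemma pure_basis t : pure e (fun b => e (t b)) = pure_tab R t.
Proof.
apply/ffunP => u; rewrite !ffunE; case: eqP => [->|ne_ut].
  by rewrite big1 // => b _; rewrite bcoord_basis eqxx.
have /existsP[b /negPf ne_b] : [exists b, u b != t b].
  apply/contra_notT: ne_ut => /existsPn eq_ut.
  by apply/ffunP => b; apply/eqP; rewrite -[_ == _]negbK.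
by rewrite (bigD1 b) //= bcoord_basis ne_b mul0r.
Qed.

Lemma tensZ a x u : (a *: x) u = a * x u.
Proof. by rewrite ffunE. Qed.

Lemma tensD x y u : (x + y) u = x u + y u.
Proof. by rewrite ffunE. Qed.

Lemma tens_sumE (I : Type) (r : seq I) (Q : pred I) (F : I -> tens R B X) u :
  (\sum_(i <- r | Q i) F i) u = \sum_(i <- r | Q i) F i u.
Proof. by rewrite sum_ffunE. Qed.

Lemma tensE x : x = \sum_t x t *: pure_tab R t.
Proof.
apply/ffunP => u; rewrite tens_sumE (bigD1 u) //= tensZ ffunE eqxx mulr1.
rewrite big1 ?addr0 // => t ne_tu.
by rewrite tensZ ffunE eq_sym (negPf ne_tu) mulr0.
Qed.

Section Action.

Variables (G : groupType) (rho : G -> V -> V).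
Hypothesis rho_rep : representation rho.

Lemma tens_act_is_linear g : linear (@tens_act R B X V e G rho g).
Proof.
move=> a x y; rewrite /tens_act scaler_sumr -big_split; apply: eq_bigr => t _ /=.
by rewrite !ffunE scalerDl scalerA.
Qed.

HB.instance Definition _ g := GRing.isLinear.Build R (tens R B X) (tens R B X) _
  (tens_act e rho g) (tens_act_is_linear g).

Lemma rho0 g : rho g 0 = 0.
Proof.
have := rep_linear rho_rep g (-1) 0 0.
by rewrite scaler0 addr0 scaleN1r addNr.
Qed.

Lemma rho_bcoord g (w : V) b :
  bcoord e (rho g w) b = \sum_x bcoord e w x * bcoord e (rho g (e x)) b.
Proof.
rewrite -bcoord_sum -{1}[w]bcoordK /lincomb; congr (bcoord e _ b).
elim/big_rec2: _ => [|x w' w'' _ <-]; first exact: rho0.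
by rewrite (rep_linear rho_rep).
Qed.

(** Expanding every [rho g (v b)] in the basis and distributing the product over the sums gives the
    basis-wise definition of [tens_act]. *)
Lemma tens_act_pure g v :
  tens_act e rho g (pure e v) = pure e (fun b => rho g (v b)).
Proof.
apply/ffunP => u; rewrite tens_sumE ffunE.
under [RHS]eq_bigr => b _ do rewrite rho_bcoord.
rewrite bigA_distr_bigA; apply: eq_bigr => t _.
by rewrite tensZ !ffunE big_split.
Qed.

Lemma eq_pure v v' : v =1 v' -> pure e v = pure e v'.
Proof.
by move=> vv'; apply/ffunP => u; rewrite !ffunE; apply: eq_bigr => b _; rewrite vv'.
Qed.

Lemma tens_rep : representation (@tens_act R B X V e G rho).
Proof.
split=> [g a x y|x|g h x]; first exact: linearP.
  rewrite [RHS]tensE /tens_act; apply: eq_bigr => t _; rewrite -pure_basis.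
  by congr (_ *: _); apply: eq_pure => b; rewrite rep_1.
rewrite [tens_act e rho h x]/tens_act linear_sum; apply: eq_bigr => t _.
rewrite linearZ /= tens_act_pure; congr (_ *: _).
by apply: eq_pure => b; rewrite rep_M.
Qed.

Lemma tens_act_tact g x (s : {perm X}) u :
  tens_act e rho g x (tact u s) =
  tens_act e rho g [ffun t => x (tact t s)] u.
Proof.
rewrite /tens_act !tens_sumE (reindex_inj (h := fun t => tact t s)) /=; last first.
  move=> t t' /ffunP tt'; apply/ffunP => b; have := tt' (s b).
  by rewrite !ffunE permK.
apply: eq_bigr => t _; rewrite !tensZ !ffunE; congr (_ * _).
rewrite [RHS](reindex_inj (h := s^-1%g)) /=; last exact: perm_inj.
by apply: eq_bigr => b _; rewrite !ffunE.
Qed.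

End Action.
End Tensor.
End Basis.

(** * Row equivalence and symmetric tensors *)

Section PlaceAction.

Variables (X T : finType).
Implicit Types (t : {ffun X -> T}) (s : {perm X}).

Lemma tact1 t : tact t 1%g = t.
Proof. by apply/ffunP => b; rewrite ffunE invg1 perm1. Qed.

Lemma tactM t s1 s2 : tact t (s1 * s2)%g = tact (tact t s1) s2.
Proof. by apply/ffunP => b; rewrite !ffunE invMg permM. Qed.

Lemma tact_perm t s b : tact t s (s b) = t b.
Proof. by rewrite ffunE permK. Qed.

Lemma tactK s : cancel (fun t => tact t s) (fun t => tact t s^-1%g).
Proof. by move=> t; rewrite -tactM mulgV tact1. Qed.

Lemma tactVK s : cancel (fun t => tact t s^-1%g) (fun t => tact t s).
Proof. by move=> t; rewrite -tactM mulVg tact1. Qed.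

Lemma card_perm_pred s (P : pred X) : #|[set b | P (s b)]| = #|[set b | P b]|.
Proof.
rewrite -[RHS](card_preimset _ (@perm_inj _ s)); apply: eq_card => b.
by rewrite !inE.
Qed.

Lemma card_tact_pred t s (P : X -> pred T) :
  (forall b y, P (s b) y = P b y) ->
  #|[set b | P b (tact t s b)]| = #|[set b | P b (t b)]|.
Proof.
move=> Ps; rewrite -(card_perm_pred s); apply: eq_card => b.
by rewrite !inE tact_perm Ps.
Qed.

End PlaceAction.

Lemma count_codom (I : finType) (T : eqType) (f : I -> T) y :
  count_mem y (codom f) = #|[set b | f b == y]|.
Proof.
rewrite /codom /image_mem count_map -size_filter cardsE cardE /enum_mem.
by rewrite -enumT -filter_predI; congr size; apply: eq_filter => b; rewrite /= andbT.
Qed.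

Section Rows.

Variables (la : seq nat) (d : Order.disp_t) (B : finOrderType d).
Local Notation tab := (tab la B).
Local Notation box := (box la).
Implicit Types (t u v w : tab) (s : {perm box}).

Lemma RPPP s : reflect (forall b, brow (s b) = brow b) (s \in RPP la).
Proof. by rewrite inE; apply: (iffP forallP) => Hs b; apply/eqP. Qed.

Lemma RPP_group_set : group_set (RPP la).
Proof.
apply/group_setP; split; first by apply/RPPP => b; rewrite perm1.
by move=> s s' /RPPP Hs /RPPP Hs'; apply/RPPP => b; rewrite permM Hs' Hs.
Qed.

Canonical RPP_group := Group RPP_group_set.

Lemma rstabP t s : reflect (s \in RPP la /\ tact t s = t) (s \in rstab t).
Proof. by rewrite [s \in rstab t]inE; apply: (iffP andP) => [[? /eqP]|[? ->]]. Qed.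

Lemma rstab_group_set t : group_set (rstab t).
Proof.
apply/group_setP; split; first by apply/rstabP; rewrite group1 tact1.
move=> s s' /rstabP[Hs ts] /rstabP[Hs' ts']; apply/rstabP.
by rewrite groupM // tactM ts ts'.
Qed.

Canonical rstab_group t := Group (rstab_group_set t).

(** Counts boxes of the diagram rather than positions in a row, so that [card_tact_pred] applies to
    place permutations. *)
Definition row_count t i y := #|[set b : box | (brow b == i) && (t b == y)]|.

Lemma row_countE t i y : row_count t i y = count_mem y (codom (row_of t i)).
Proof.
rewrite count_codom /row_count.
pose T (j : 'I_(nth 0%N la i)) : box :=
  Tagged (fun i : 'I_(size la) => 'I_(nth 0%N la i)) j.
have T_inj : injective T by move=> j j' /eqP; rewrite eq_Tagged => /eqP.
rewrite -(card_imset _ T_inj); apply: eq_card => b; rewrite !inE.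
apply/andP/imsetP => [[]|[j + ->]]; last by rewrite inE ffunE => ->; rewrite eqxx.
case: b => i' j /eqP/= ei ej; rewrite /brow /= in ei; subst i'.
by exists j; rewrite // inE ffunE ej.
Qed.

Lemma row_equivP t u :
  reflect (forall i y, row_count t i y = row_count u i y) (row_equiv t u).
Proof.
apply: (iffP forallP) => [tu i y|tu i].
  by rewrite !row_countE; apply/seq.permP.
by apply/allP => y _; rewrite /= -!row_countE tu.
Qed.

Lemma row_equivE t u :
  row_equiv t u <-> exists2 s, s \in RPP la & u = tact t s.
Proof.
split=> [/row_equivP tu|[s /RPPP Hs ->]]; last first.
  apply/row_equivP => i y.
  apply/esym; pose P (b : box) z := (brow b == i) && (z == y).
  by apply: (card_tact_pred t (P := P)) => b z; rewrite /P Hs.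
(* Matching pairs of row and entry makes the permutation row-preserving. *)
have [|s Hs] := @eq_fiber_perm box _ (fun b => (brow b, t b)) (fun b => (brow b, u b)).
  case=> i y; have := tu i y; rewrite /row_count => tuiy.
  by under eq_finset => b do rewrite xpair_eqE; rewrite tuiy.
exists s^-1%g; first by rewrite groupV; apply/RPPP => b; case: (Hs b).
by apply/ffunP => b; rewrite ffunE invgK; case: (Hs b).
Qed.

Lemma row_equiv_refl t : row_equiv t t. Proof. exact/row_equivP. Qed.

Lemma row_equiv_sym t u : row_equiv t u = row_equiv u t.
Proof. by apply/row_equivP/row_equivP => tu i y; rewrite tu. Qed.

Lemma row_equiv_trans u t v : row_equiv t u -> row_equiv u v -> row_equiv t v.
Proof.
by move=> /row_equivP tu /row_equivP uv; apply/row_equivP => i y; rewrite tu.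
Qed.

Lemma row_equiv_eqv (T : {set tab}) : {in T & &, equivalence_rel (@row_equiv la d B)}.
Proof.
move=> t u v _ _ _; split; first exact: row_equiv_refl.
move=> tu; apply/idP/idP; last exact: row_equiv_trans.
by apply: row_equiv_trans; rewrite row_equiv_sym.
Qed.

(** At a Garnir orbit this unfolds to [Garnir_reps]. *)
Definition row_reps (T : {set tab}) : {set tab} :=
  finset.transversal (equivalence_partition (@row_equiv la d B) T) T.

Section Reps.

Variable T : {set tab}.

Let partT := equivalence_partitionP (@row_equiv_eqv T).
Let trT := transversalP partT.

Lemma row_reps_sub u : u \in row_reps T -> u \in T.
Proof. exact: (fintype.subsetP (transversal_sub trT)). Qed.

Lemma row_reps_inj u v :
  u \in row_reps T -> v \in row_reps T -> row_equiv u v -> u = v.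
Proof.
move=> Xu Xv uv; apply: (pblock_inj trT) => //; apply: same_pblock.
  by case/and3P: partT.
rewrite (pblock_equivalence_partition (@row_equiv_eqv T)) ?row_reps_sub //.
by rewrite row_equiv_sym.
Qed.

Lemma row_repsP v : v \in T -> exists2 u, u \in row_reps T & row_equiv u v.
Proof.
move=> Tv; have: finset.pblock (equivalence_partition (@row_equiv la d B) T) v \in
   equivalence_partition (@row_equiv la d B) T.
  by apply: pblock_mem; rewrite (cover_partition partT).
rewrite -{2}(pblock_transversal trT) => /imsetP[u Xu Euv]; exists u => //.
have : v \in finset.pblock (equivalence_partition (@row_equiv la d B) T) v.
  by rewrite mem_pblock (cover_partition partT).
by rewrite Euv (pblock_equivalence_partition (@row_equiv_eqv T)) // row_reps_sub.
Qed.

End Reps.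

Variable R : comPzRingType.
Local Notation tensor := (tens R B box).

(** By orbit-stabiliser the cosets of [rstab t] enumerate the row class of [t] without repetition,
    so [rsym R t] is the indicator function of that class. *)
Lemma rsymE t u : rsym R t u = (row_equiv t u)%:R.
Proof.
rewrite /rsym tens_sumE.
have repr_tact s : tact t (repr (rstab t :* s)%g) = tact t s.
  by case: repr_rcosetP => h /rstabP[_ th]; rewrite tactM th.
case: (boolP (row_equiv t u)) => [/row_equivE[s Hs ->]|ntu].
  rewrite (bigD1 (rstab t :* s)%g) /=; last by apply/rcosetsP; exists s.
  rewrite ffunE repr_tact eqxx big1 ?addr0 // => C /andP[/rcosetsP[s' Hs' ->]] /eqP ne.
  rewrite ffunE repr_tact; case: eqP => // ss'; case: ne; apply/rcoset_eqP.
  rewrite mem_rcoset; apply/rstabP; rewrite groupM ?groupV //; split=> //.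
  by rewrite tactM -ss' tactK.
rewrite big1 // => C /rcosetsP[s Hs ->]; rewrite ffunE repr_tact.
case: eqP => // us; case/negP: ntu.
by apply/row_equivE; exists s.
Qed.

Lemma eq_rsym t u : row_equiv t u -> rsym R t = rsym R u.
Proof.
move=> tu; apply/ffunP => w; rewrite !rsymE; congr (_ : bool)%:R.
apply/idP/idP; last exact: row_equiv_trans.
by apply: row_equiv_trans; rewrite row_equiv_sym.
Qed.

Lemma row_reps_sum (T : {set tab}) (F : tab -> R) u w : u \in row_reps T ->
  row_equiv u w -> (\sum_(v in row_reps T) F v *: rsym R v) w = F u.
Proof.
move=> Xu uw; rewrite tens_sumE (bigD1 u) //= tensZ rsymE uw mulr1.
rewrite big1 ?addr0 // => v /andP[Xv /eqP nvu]; rewrite tensZ rsymE.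
case: (boolP (row_equiv v w)) => [vw|]; last by rewrite mulr0.
case: nvu; apply: (row_reps_inj Xv Xu).
by apply: row_equiv_trans vw _; rewrite row_equiv_sym.
Qed.

Lemma row_reps_sum0 (T : {set tab}) (F : tab -> R) w :
  (forall u, u \in T -> ~~ row_equiv u w) ->
  (\sum_(v in row_reps T) F v *: rsym R v) w = 0.
Proof.
move=> Tw; rewrite tens_sumE big1 // => v /row_reps_sub /Tw/negPf vw.
by rewrite tensZ rsymE vw mulr0.
Qed.

Lemma prod_nat_bool (I : finType) (P : pred I) :
  \prod_i (P i)%:R = [forall i, P i]%:R :> R.
Proof.
have [/forallP PT|/forallPn[i /negPf Pi]] := boolP [forall i, P i].
  by rewrite big1 // => i _; rewrite PT.
by rewrite (bigD1 i) //= Pi mul0r.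
Qed.

(** The indicator of a row class is a product over the rows of indicators of multisets, each of
    which is a symmetric tensor. *)
Lemma rsym_Symlambda t : Symlambda la B R (rsym R t).
Proof.
apply: rspan_gen.
exists (fun i : 'I_(size la) => [ffun f : {ffun 'I_(nth 0%N la i) -> B} =>
            (perm_eq (codom (row_of t i)) (codom f))%:R]).
  move=> i s f; rewrite !ffunE.
  suff /permPr-> : perm_eq (codom (tact f s)) (codom f) by [].
  apply/allP => y _ /=; rewrite !count_codom; apply/eqP.
  exact: (card_tact_pred f (P := fun _ => pred1 y)).
apply/ffunP => u; rewrite rsymE ffunE -prod_nat_bool.
by apply: eq_bigr => i _; rewrite ffunE.
Qed.

Lemma row_invariant_sum (z : tensor) :
  (forall t u, row_equiv t u -> z t = z u) ->
  z = \sum_(v in row_reps [set: tab]%SET) z v *: rsym R v.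
Proof.
move=> Hz; apply/ffunP => w.
have [u Xu uw] := row_repsP (finset.in_setT (w : tab)).
by rewrite (row_reps_sum _ Xu uw) (Hz _ _ uw).
Qed.

(** A function constant on row classes is a combination of the indicators [rsym]. Conversely, the
    rows of row equivalent tableaux differ by place permutations, under which each symmetric factor
    is invariant. *)
Lemma SymlambdaP (z : tensor) :
  Symlambda la B R z <-> forall t u, row_equiv t u -> z t = z u.
Proof.
split=> [Sz t u|/row_invariant_sum->]; last first.
  by apply: rspan_sum => v _; apply: rspanZ; exact: rsym_Symlambda.
move: z Sz; apply: rspan_ind => [tu|a x y [f Hf ->] IHy tu].
  by rewrite !ffunE.
rewrite !ffunE (IHy tu); congr (_ *: _ + _); apply: eq_bigr => i _.
have [|s Hs] := @eq_fiber_perm _ _ (row_of t i) (row_of u i).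
  by move=> y'; rewrite -!count_codom; move/forallP: tu => /(_ i)/seq.permP.
rewrite -(Hf i s^-1%g); congr (f i _).
by apply/ffunP => j; rewrite ffunE invgK Hs.
Qed.

End Rows.

(** * Exterior powers *)

Section PureSwap.

Variables (R : comPzRingType) (V : lmodType R) (B X : finType) (e : B -> V).
Variables (v : X -> V) (b b' : X).
Hypothesis ne_bb' : b != b'.

Let upd p q c := if c == b then p else if c == b' then q else v c.

(** Isolates the factors at [b] and [b'], in which the pure tensor is then visibly bilinear. *)
Lemma pure_updE p q u : pure e (upd p q) u =
  bcoord e p (u b) * (bcoord e q (u b') *
    \prod_(c | (c != b) && (c != b')) bcoord e (v c) (u c)).
Proof.
rewrite ffunE (bigD1 b) //= (bigD1 b') 1?eq_sym //= /upd eqxx.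
rewrite [b' == b]eq_sym (negPf ne_bb') eqxx; congr (_ * (_ * _)).
by apply: eq_bigr => c /andP[/negPf-> /negPf->].
Qed.


End PureSwap.

Section Ext.

Variables (la : seq nat) (d : Order.disp_t) (B : finOrderType d).
Variables (R : comPzRingType) (V : lmodType R) (e : B -> V).
Hypothesis e_basis : is_basis (fun _ : V => True) e.
Local Notation tab := (tab la B).
Local Notation box := (box la).
Local Notation tensor := (tens R B box).
Implicit Types (t u v w : tab) (s : {perm box}).

Lemma to_ext_is_linear : linear (to_ext e : tensor -> ext la e).
Proof. exact: (to_quotm_is_linear (col_repeat e)). Qed.

HB.instance Definition _ :=
  GRing.isLinear.Build R tensor (ext la e) _ (to_ext e) to_ext_is_linear.

Lemma to_ext0 (z : tensor) : to_ext e z = 0 <-> rspan (col_repeat e) z.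
Proof. exact: to_quotm0. Qed.

Lemma to_ext_repeat (v : box -> V) b b' : b != b' -> bcol b = bcol b' ->
  v b = v b' -> to_ext e (pure e v) = 0.
Proof. by move=> ? ? ?; apply/to_ext0/rspan_gen; exists v, b, b'. Qed.

Lemma to_ext_repeat_tab t b b' : b != b' -> bcol b = bcol b' ->
  t b = t b' -> to_ext e (pure_tab R t) = 0.
Proof.
move=> ne_bb' cbb' tbb'; rewrite -(pure_basis e_basis).
by apply: to_ext_repeat ne_bb' cbb' _; rewrite tbb'.
Qed.

(** The relations only kill repeated factors; antisymmetry follows by polarisation, with the sum of
    the two entries placed in both boxes. *)
Lemma to_ext_swap t b b' : b != b' -> bcol b = bcol b' ->
  to_ext e (pure_tab R (tact t (tperm b b'))) = - to_ext e (pure_tab R t).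
Proof.
move=> ne_bb' cbb'; apply/eqP; rewrite -addr_eq0 -!(pure_basis e_basis); apply/eqP.
pose upd p q c := if c == b then p else if c == b' then q else e (t c).
have Eupd := pure_updE e (fun c => e (t c)) ne_bb'.
have upd0 p : to_ext e (pure e (upd p p)) = 0.
  apply: (to_ext_repeat ne_bb' cbb').
  by rewrite /upd eqxx [b' == b]eq_sym (negPf ne_bb') eqxx.
have Ds : pure e (upd (e (t b) + e (t b')) (e (t b) + e (t b'))) =
    (pure e (upd (e (t b)) (e (t b))) + pure e (upd (e (t b')) (e (t b')))) +
    (pure e (upd (e (t b')) (e (t b))) + pure e (upd (e (t b)) (e (t b')))) :> tensor.
  apply/ffunP => u; rewrite !tensD !Eupd !bcoordD //; set z := \prod_(c | _) _.
  rewrite !(mulrDl, mulrDr) -!addrA; congr (_ + _).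
  by rewrite addrC -addrA addrCA.
move: (upd0 (e (t b) + e (t b'))); rewrite Ds !raddfD /= !upd0 !add0r => <-.
congr (to_ext e _ + to_ext e _); apply: eq_pure => c; rewrite /upd ?ffunE.
  by rewrite tpermV; case: tpermP => [->|->|/eqP/negPf-> /eqP/negPf->//];
    rewrite ?eqxx // [b' == b]eq_sym (negPf ne_bb').
by do 2!case: eqP => [->//|_].
Qed.

Section Action.

Variables (G : groupType) (rho : G -> V -> V).
Hypothesis rho_rep : representation rho.

Lemma tens_act_col_repeat g (z : tensor) :
  rspan (col_repeat e) z -> rspan (col_repeat e) (tens_act e rho g z).
Proof.
move: z; apply: rspan_ind => [|a x y [v [b [b' [ne cc vv ->]]]] Hy].
  by rewrite linear0; exact: rspan0.
rewrite linearP; apply: rspan_lin => //; apply: rspan_gen.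
exists (fun c => rho g (v c)), b, b'; split=> //; first by rewrite vv.
exact: tens_act_pure.
Qed.

(** [ext_act] goes through a chosen representative; the choice is harmless because the action
    preserves the relations. *)
Lemma ext_actE g (z : tensor) :
  ext_act e rho g (to_ext e z) = to_ext e (tens_act e rho g z).
Proof.
apply/to_quotm_eq; rewrite -linearB; apply: tens_act_col_repeat.
by apply/to_quotm_eq; exact: reprK.
Qed.

Lemma ext_rep : representation (@ext_act la d B R V e G rho).
Proof.
have [lin_rho rho1 rhoM] := @tens_rep _ _ _ _ e_basis box _ _ rho_rep.
split=> [g a p q|q|g h q].
- have [x ->] := to_quotm_surj p; have [y ->] := to_quotm_surj q.
  rewrite -!/(to_ext e _) -linearP !ext_actE -linearP.
  by congr (to_ext e _); exact: lin_rho.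
- have [x ->] := to_quotm_surj q.
  by rewrite -!/(to_ext e _) ext_actE rho1.
- have [x ->] := to_quotm_surj q.
  by rewrite -!/(to_ext e _) !ext_actE rhoM.
Qed.

Lemma tens_act_Sym g (z : tensor) :
  Symlambda la B R z -> Symlambda la B R (tens_act e rho g z).
Proof.
move=> /SymlambdaP Hz; apply/SymlambdaP => t u /row_equivE[s Hs ->].
rewrite tens_act_tact; congr (tens_act e rho g _ t).
by apply/ffunP => w; rewrite ffunE; apply: Hz; apply/row_equivE; exists s.
Qed.

End Action.

Lemma to_ext_rsym t : to_ext e (rsym R t) = copolytabloid e t.
Proof. by rewrite /rsym linear_sum. Qed.

Definition col_perms : {set {perm box}} :=
  [set s : {perm box} | [forall b, bcol (s b) == bcol b]]%SET.

Lemma col_permsP s : reflect (forall b, bcol (s b) = bcol b) (s \in col_perms).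
Proof. by rewrite inE; apply: (iffP forallP) => Hs b; apply/eqP. Qed.

(** The pairing with the signed column sum of [w], as in the definition of polytabloids. *)
Definition alt w (z : tensor) : R :=
  \sum_(s in col_perms) (-1) ^+ s * z (tact w s).

Lemma alt_lin w a x y : alt w (a *: x + y) = a * alt w x + alt w y.
Proof.
rewrite /alt mulr_sumr -big_split; apply: eq_bigr => s _ /=.
by rewrite ffunE tensZ mulrDr mulrCA.
Qed.

Lemma alt0 w : alt w 0 = 0.
Proof. by rewrite /alt big1 // => s _; rewrite ffunE mulr0. Qed.

Lemma alt_sum w (I : Type) (r : seq I) (c : I -> R) (f : I -> tensor) :
  alt w (\sum_(i <- r) c i *: f i) = \sum_(i <- r) c i * alt w (f i).
Proof.
by elim: r => [|i r IHr]; rewrite ?big_nil ?alt0 // !big_cons alt_lin IHr.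
Qed.

(** Multiplying by the transposition of the two boxes with equal factors exchanges even and odd
    column permutations and keeps the coefficient, so the terms cancel in pairs, in characteristic 2
    as well. *)
Lemma alt_col_repeat w (z : tensor) : rspan (col_repeat e) z -> alt w z = 0.
Proof.
move: z; apply: rspan_ind => [|a x y [v [b [b' [ne cc vv ->]]]] Hy].
  exact: alt0.
rewrite alt_lin Hy addr0 (_ : alt w _ = 0) ?mulr0 //.
rewrite /alt (bigID (fun s : {perm box} => odd_perm s)) /= addrC; apply/eqP.
rewrite addr_eq0 -sumrN; apply/eqP.
have tpc c : bcol (tperm b b' c) = bcol c by case: tpermP => [->|->|].
have tpv c : v (tperm b b' c) = v c by case: tpermP => [->|->|].
rewrite (reindex_inj (mulIg (tperm b b'))) /=.
apply: eq_big => s.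
  rewrite odd_permM odd_tperm ne addbT negbK; congr (_ && _).
  by apply/col_permsP/col_permsP => Hs c; have := Hs c; rewrite permM tpc.
case/andP=> _; rewrite odd_permM odd_tperm ne addbT negbK => odd_s.
rewrite odd_s expr0 expr1 mul1r mulN1r opprK !ffunE.
rewrite (reindex_inj (@perm_inj _ (tperm b b'))) /=.
by apply: eq_bigr => c _; rewrite !ffunE tpv invMg permM tpermV tpermK.
Qed.

End Ext.

(** * Dual Garnir relations *)

Section Garnir.

Variables (la : seq nat) (d : Order.disp_t) (B : finOrderType d).
Local Notation tab := (tab la B).
Local Notation box := (box la).
Implicit Types (t u v w : tab) (s : {perm box}) (X : {set box}).

Lemma box_inj (b b' : box) : brow b = brow b' -> bcol b = bcol b' -> b = b'.
Proof.
case: b b' => [i j] [i' j']; rewrite /brow /bcol /= => ei; subst i' => /ord_inj ej.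
by rewrite ej.
Qed.

Lemma bcol_lt (b : box) : (bcol b < nth 0 la (brow b))%N.
Proof. exact: ltn_ord. Qed.

(** The group [Sym X] times the row-preserving permutations off [X], given by pointwise conditions
    so that closure under products is direct. *)
Definition block_perms X : {set {perm box}} :=
  [set s : {perm box} | [forall b, ((s b \in X) == (b \in X)) &&
     ((b \notin X) ==> (brow (s b) == brow b))]]%SET.

Lemma block_permsP X s :
  reflect ((forall b, (s b \in X) = (b \in X)) /\
           (forall b, b \notin X -> brow (s b) = brow b)) (s \in block_perms X).
Proof.
rewrite inE; apply: (iffP forallP) => [Hs|[Hs1 Hs2] b].
  by split=> b; have /andP[/eqP ? /implyP H] := Hs b => // /H /eqP.
by rewrite Hs1 eqxx; apply/implyP => /Hs2 ->.
Qed.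

Lemma block_perms_group_set X : group_set (block_perms X).
Proof.
apply/group_setP; split; first by apply/block_permsP; split=> b; rewrite perm1.
move=> s s' /block_permsP[Hs1 Hs2] /block_permsP[Hs'1 Hs'2].
apply/block_permsP; split=> b; rewrite permM; first by rewrite Hs'1 Hs1.
by move=> Xb; rewrite Hs'2 ?Hs1 // Hs2.
Qed.

Canonical block_perms_group X := Group (block_perms_group_set X).

Lemma Sym_block X s : s \in Sym X -> s \in block_perms X.
Proof.
rewrite inE => sX; apply/block_permsP; split=> b; first exact: perm_closed.
by move=> Xb; rewrite (out_perm sX).
Qed.

Lemma block_decomp X s : s \in block_perms X -> exists h k,
  [/\ h \in Sym X, k \in Sym (~: X), k \in RPP la & s = (h * k)%g].
Proof.
(* [h] agrees with [s] on [X] and is the identity elsewhere, so [h^-1 * s] fixes [X] pointwise. *)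
move=> /block_permsP[Hs1 Hs2]; pose h := restr_perm X s.
have hX : h \in Sym X by rewrite inE; exact: restr_perm_on.
have hE b : b \in X -> h b = s b by apply: restr_permE; apply/astabsP.
have hXE : perm_on X h by move: hX; rewrite inE.
have kE b : b \in X -> (h^-1 * s)%g b = b.
  move=> Xb; rewrite permM -hE ?permKV // -(perm_closed _ hXE) permKV.
  exact: Xb.
have kE' b : b \notin X -> (h^-1 * s)%g b = s b.
  by move=> Xb; rewrite permM (out_perm (perm_onV hXE)).
exists h, (h^-1 * s)%g; split=> //; last by rewrite mulKVg.
  rewrite inE; apply/fintype.subsetP => b; rewrite !inE; apply: contraNN => Xb.
  by rewrite kE.
apply/RPPP => b; case: (boolP (b \in X)) => Xb; first by rewrite kE.
by rewrite kE' // Hs2.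
Qed.

(** Links the Young subgroup in the index of [dual_Garnir] to [block_perms]: for row permutations
    the condition off [X] is automatic. *)
Lemma RPP_block X s : s \in RPP la ->
  (s \in (Sym X * Sym (~: X))%g) = (s \in block_perms X).
Proof.
move=> /RPPP Hs; apply/mulsgP/idP => [[h k]|]; last first.
  by move=> /block_decomp[h [k [hX kX _ ->]]]; exists h k.
rewrite [h \in _]inE [k \in _]inE => hX kX Es.
apply/block_permsP; split=> b; last first.
  by move=> Xb; rewrite Hs.
rewrite Es permM -(perm_closed b hX); have := perm_closed (h b) kX.
by rewrite !inE => /negb_inj.
Qed.

(** Off [X] the permutation [s] keeps rows, so the row multiplicities off [X] agree; subtracting
    them from the totals, so do those inside [X]. Fibres of the triple (membership in [X], row,
    entry) then match. *)
Lemma block_row_equiv X u v s : s \in block_perms X -> v = tact u s ->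
  row_equiv u v -> exists2 k, k \in (RPP la :&: block_perms X)%SET & v = tact u k.
Proof.
move=> /block_permsP[Hs1 Hs2] Ev uv.
have off i y : #|[set b | (b \notin X) && ((brow b == i) && (v b == y))]%SET| =
               #|[set b | (b \notin X) && ((brow b == i) && (u b == y))]%SET|.
  pose P (b : box) z := (b \notin X) && ((brow b == i) && (z == y)).
  rewrite Ev; apply: (card_tact_pred u (P := P)) => b z; rewrite /P Hs1.
  by case: (boolP (b \in X)) => //= Xb; rewrite Hs2.
have split_count w i y : row_count w i y =
    (#|[set b | (b \in X) && ((brow b == i) && (w b == y))]%SET| +
     #|[set b | (b \notin X) && ((brow b == i) && (w b == y))]%SET|)%N.
  rewrite /row_count -[LHS](cardsID X); congr (_ + _)%N; apply: eq_card => b;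
    by rewrite !inE // andbC.
have [|k Hk] := @eq_fiber_perm box _ (fun b => (b \in X, brow b, u b))
                  (fun b => (b \in X, brow b, v b)).
  case=> [[x i] y].
  have H w : #|[set b : box | (b \in X, brow b, w b) == (x, i, y)]%SET| =
    #|[set b | ((b \in X) == x) && ((brow b == i) && (w b == y))]%SET|.
    by apply: eq_card => b; rewrite !inE !xpair_eqE andbA.
  rewrite !H; case: x {H}; last first.
    have Hn w : #|[set b | ((b \in X) == false) && ((brow b == i) && (w b == y))]%SET|
      = #|[set b | (b \notin X) && ((brow b == i) && (w b == y))]%SET|.
      by apply: eq_card => b; rewrite !inE eqbF_neg.
    by rewrite !Hn off.
  have Ht w : #|[set b | ((b \in X) == true) && ((brow b == i) && (w b == y))]%SET|
      = #|[set b | (b \in X) && ((brow b == i) && (w b == y))]%SET|.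
    by apply: eq_card => b; rewrite !inE eqb_id.
  rewrite !Ht; move/row_equivP: uv => /(_ i y); rewrite !split_count off.
  by move/addIn.
exists k^-1%g; last by apply/ffunP => b; rewrite ffunE invgK; case: (Hk b).
rewrite finset.in_setI !groupV; apply/andP; split.
  by apply/RPPP => b; case: (Hk b).
by apply/block_permsP; split=> b; case: (Hk b).
Qed.

(** * Coset expansion of a dual Garnir relation and its vanishing *)

Section Coefficients.

Variables (t : tab) (A C : {set box}).
Local Notation X := (A :|: C)%SET.
Local Notation K := (RPP la :&: block_perms X)%SET.
Local Notation T := (Garnir_orbit t A C).

(** The Garnir orbit enlarged by row permutations off [X], which makes it stable under [K]. *)
Definition block_orbit : {set tab} := [set tact t s | s in block_perms X]%SET.

Definition Garnir_coef u : nat :=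
  #|rstab u : rstab u :&: (Sym X * Sym (~: X))|%g.

Lemma Garnir_orbitP u :
  reflect (exists2 h, h \in Sym X & u = tact t h) (u \in T).
Proof. exact: imsetP. Qed.

Lemma Garnir_coefE u : Garnir_coef u = #|rcosets K (rstab u)|.
Proof.
rewrite -[RHS]/(#|rstab u : K|%g) -indexgI /Garnir_coef; congr #|_ : _|%g.
apply/setP => s; rewrite !finset.in_setI.
case: (boolP (s \in rstab u)) => //= /rstabP[Hs _].
by rewrite RPP_block // Hs.
Qed.

Lemma dual_GarnirE (R : comPzRingType) :
  dual_Garnir R t A C = \sum_(u in row_reps T) (Garnir_coef u)%:R *: rsym R u.
Proof. by apply: eq_bigr => u _; rewrite scaler_nat. Qed.

(** The inverse of a coset [K q] carries [u.r] into [block_orbit] exactly when [K q = K g r] for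
    some [g] in [rstab u]. The coefficient thus counts translates of [block_orbit] and, within the
    orbit, depends only on the row class. *)
Lemma Garnir_coef_count u r : u \in T -> r \in RPP la ->
  #|[set D in rcosets K (RPP la) | tact (tact u r) (repr D)^-1%g \in block_orbit]%SET|
    = Garnir_coef u.
Proof.
case/Garnir_orbitP=> h hX Eu Hr; rewrite Garnir_coefE.
rewrite -[RHS](card_imset _ (@rcoset_inj _ r)); apply: eq_card => D; rewrite inE.
have hb := Sym_block hX.
apply/andP/imsetP => [[/rcosetsP[q Hq ->]]|[_ /rcosetsP[g Hg ->] ->]]; last first.
  have [Hg1 Hg2] := rstabP _ _ Hg.
  rewrite -rcosetM; split; first by apply/rcosetsP; exists (g * r)%g; rewrite ?groupM.
  case: repr_rcosetP => k; rewrite finset.in_setI => /andP[_ Hk].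
  rewrite -tactM !invMg !mulgA mulgV mul1g tactM.
  have -> : tact u g^-1%g = u by rewrite -{1}Hg2 tactK.
  by rewrite Eu -tactM; apply/imsetP; exists (h * k^-1)%g; rewrite ?groupM ?groupV.
case: repr_rcosetP => k0; rewrite finset.in_setI => /andP[Hk01 Hk02].
case/imsetP=> l Hl El.
have [] := @block_row_equiv X u (tact (tact u r) (k0 * q)^-1%g) (h^-1 * l)%g.
- by rewrite groupM ?groupV.
- by rewrite El Eu -tactM mulKVg.
- apply/row_equivE; exists (r * (k0 * q)^-1)%g; last by rewrite tactM.
  by rewrite groupM ?groupV ?groupM.
move=> k; rewrite finset.in_setI => /andP[Hk1 Hk2] Ek.
(* [g] fixes [u] because [u.k = u.r.(k0 q)^-1], and [K g r = K q] because [k] and [k0] lie in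
   [K]. *)
pose g := (k * (k0 * q) * r^-1)%g.
have Hg : g \in rstab u.
  apply/rstabP; split; first by rewrite !groupM ?groupV.
  by rewrite /g 2!tactM -Ek tactVK tactK.
exists (K :* g)%g; first by apply/rcosetsP; exists g.
rewrite -rcosetM /g mulgKV mulgA rcosetM; congr (_ :* q)%g.
by rewrite rcoset_id //; apply: groupM; rewrite finset.in_setI ?Hk1 ?Hk01.
Qed.

Lemma block_orbit_row_equiv v s : s \in RPP la -> tact v s^-1%g \in block_orbit ->
  exists2 u, u \in T & row_equiv u v.
Proof.
move=> Hs /imsetP[l /block_decomp[h [k [hX _ Hk ->]]] Ev].
exists (tact t h); first by apply/Garnir_orbitP; exists h.
apply/row_equivE; exists (k * s)%g; first by rewrite groupM.
by rewrite tactM -[tact (tact t h) k]tactM -Ev tactVK.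
Qed.

(** On the right, the coefficient at [w] is the number of coset translates of [block_orbit]
    containing [w], known from [Garnir_coef_count]; off the row classes of the orbit both sides
    vanish. *)
Lemma dual_Garnir_cosets (R : comPzRingType) : dual_Garnir R t A C =
  \sum_(D in rcosets K (RPP la)) \sum_(v in block_orbit) pure_tab R (tact v (repr D)).
Proof.
apply/ffunP => w; rewrite dual_GarnirE [RHS]tens_sumE.
have inner s : (\sum_(v in block_orbit) pure_tab R (tact v s)) w =
               (tact w s^-1%g \in block_orbit)%:R.
  rewrite tens_sumE; case: (boolP (_ \in _)) => [Hw|Hw].
    rewrite (bigD1 _ Hw) /= ffunE tactVK eqxx big1 ?addr0 // => v /andP[_ ne].
    by rewrite ffunE; case: eqP => // Ew; case/eqP: ne; rewrite Ew tactK.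
  rewrite big1 // => v Hv; rewrite ffunE; case: eqP => // Ew.
  by case/negP: Hw; rewrite Ew tactK.
under [RHS]eq_bigr => D _ do rewrite inner.
case: (boolP [exists u in T, row_equiv u w]) => [/exists_inP[u Tu uw]|Tw].
  have [u0 Xu0 u0u] := row_repsP Tu; have u0w := row_equiv_trans u0u uw.
  rewrite (row_reps_sum _ Xu0 u0w); have /row_equivE[r Hr Ew] := u0w.
  rewrite -(Garnir_coef_count (row_reps_sub Xu0) Hr) -Ew -natr_sum; congr _%:R.
  rewrite -sum1dep_card big_mkcondr; apply: eq_bigr => D _.
  by case: (_ \in block_orbit).
rewrite row_reps_sum0; last first.
  by move=> u Tu; apply: contraNN Tw => uw; apply/exists_inP; exists u.
rewrite big1 // => D /rcosetsP[s Hs ->].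
case: repr_rcosetP => k; rewrite finset.in_setI => /andP[Hk _].
case: (boolP (_ \in block_orbit)) => // /block_orbit_row_equiv[].
  by rewrite groupM.
by move=> u Tu uw; case/exists_inP: Tw; exists u.
Qed.

Variables (i i' : 'I_(size la)).
Hypothesis ii' : (i < i')%N.
Hypotheses (subA : A \subset row_boxes i) (subC : C \subset row_boxes i').

Let rowA b : b \in A -> brow b = i.
Proof. by move/(fintype.subsetP subA); rewrite inE => /eqP. Qed.

Let rowC b : b \in C -> brow b = i'.
Proof. by move/(fintype.subsetP subC); rewrite inE => /eqP. Qed.

Let disAC : [disjoint A & C].
Proof.
rewrite disjoint_subset; apply/fintype.subsetP => b Ab; rewrite inE.
by apply/negP => /rowC bi'; move: ii'; rewrite -bi' -(rowA Ab) ltnn.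
Qed.

(** Pigeonhole: [s] keeps [A] and [C] in their rows, whose columns all lie below the length of the
    upper row, and boxes of one row have distinct columns. A collision must be between [A] and
    [C]. *)
Lemma same_column n s : is_part n la -> (nth 0 la i < #|A| + #|C|)%N ->
  s \in RPP la -> exists b b', [/\ b \in A, b' \in C & bcol (s b) = bcol (s b')].
Proof.
case/and3P=> sorted_la _ _ ltAC /RPPP Hs; apply: contrapT => nAC.
have lei : (nth 0 la i' <= nth 0 la i)%N.
  have geq_trans : transitive geq by move=> x y z /= xy yz; exact: leq_trans yz xy.
  have := sorted_leq_nth geq_trans leqnn 0%N sorted_la.
  by move=> /(_ i i'); rewrite !inE !ltn_ord => /(_ isT isT (ltnW ii')).
have inj : {in (A :|: C)%SET &, injective (fun b => bcol (s b))}.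
  have row_inj b b' : brow b = brow b' -> bcol (s b) = bcol (s b') -> b = b'.
    by move=> ebb' /box_inj ss; apply: (@perm_inj _ s); apply: ss; rewrite !Hs.
  move=> b b'; rewrite !finset.in_setU => /orP[Ab|Cb] /orP[Ab'|Cb'] ebb'.
  - by apply: row_inj => //; rewrite !rowA.
  - by case: nAC; exists b, b'.
  - by case: nAC; exists b', b.
  - by apply: row_inj => //; rewrite !rowC.
have: (size [seq bcol (s b) | b <- enum (A :|: C)%SET] <= size (iota 0 (nth 0 la i)))%N.
  apply: uniq_leq_size => [|_ /mapP[b + ->]].
    by rewrite map_inj_in_uniq ?enum_uniq // => b b'; rewrite !mem_enum; exact: inj.
  rewrite mem_enum finset.in_setU mem_iota /= add0n => /orP[/rowA Eb|/rowC Eb].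
    by rewrite -Eb -(Hs b) bcol_lt.
  by apply: (leq_trans _ lei); rewrite -Eb -(Hs b) bcol_lt.
rewrite size_map size_iota -cardE cardsU (_ : A :&: C = finset.set0)%SET.
  by rewrite cards0 subn0 leqNgt ltAC.
by apply/eqP; rewrite setI_eq0.
Qed.

Lemma to_ext_dual_Garnir n (R : comPzRingType) (V : lmodType R) (e : B -> V) :
  is_basis (fun _ : V => True) e -> is_part n la ->
  (nth 0 la i < #|A| + #|C|)%N -> to_ext e (dual_Garnir R t A C) = 0.
Proof.
move=> e_basis la_part ltAC; rewrite dual_Garnir_cosets linear_sum /= big1 //.
move=> D /rcosetsP[s Hs ->]; have: repr (K :* s)%g \in RPP la.
  by case: repr_rcosetP => k; rewrite finset.in_setI => /andP[Hk _]; rewrite groupM.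
move: (repr _) => q Hq; have [b [b' [Ab Cb' ebb']]] := same_column la_part ltAC Hq.
have ne_bb' : q b != q b'.
  by apply/eqP => /perm_inj Eb; move: ii'; rewrite -(rowA Ab) Eb (rowC Cb') ltnn.
pose tp := tperm b b'; pose F v := to_ext e (pure_tab R (tact v q)).
have tpX : tp \in block_perms X.
  apply: Sym_block; rewrite inE; apply: (fintype.subset_trans (tperm_on b b')).
  by apply/fintype.subsetP => c /[!inE] /orP[]/eqP->; rewrite ?Ab ?Cb' ?orbT.
(* Conjugating [tp] by [q] gives the transposition of [q b] and [q b'], which share a column. *)
have FN v : F (tact v tp) = - F v.
  by rewrite /F -tactM conjgC tpermJ tactM (to_ext_swap e_basis).
have F0 v : v b = v b' -> F v = 0.
  by move=> vbb'; apply: (to_ext_repeat_tab e_basis ne_bb' ebb'); rewrite !tact_perm.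
have tpW v : (tact v tp \in block_orbit) = (v \in block_orbit).
  have stable u : u \in block_orbit -> tact u tp \in block_orbit.
    case/imsetP=> l Hl ->; rewrite -tactM.
    by apply/imsetP; exists (l * tp)%g; rewrite ?groupM.
  by apply/idP/idP => /stable //; rewrite -tactM tperm2 tact1.
rewrite linear_sum /= -/(F _).
(* The order on entries picks one element of each orbit of the involution, as
   [F v = - F v] alone does not give [F v = 0] in characteristic 2. *)
rewrite (eq_bigr (fun v => (if (v b < v b')%O then F v else 0) +
                           (if (v b' < v b)%O then F v else 0))); last first.
  move=> v _; rewrite -/(F v).
  by case: ltgtP => [||/F0->]; rewrite ?addr0 ?add0r.
rewrite big_split /= [X in _ + X](reindex_inj (can_inj (tactK tp))) /=.
rewrite (eq_bigl _ _ tpW) -big_split big1 //= => v _.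
rewrite FN !ffunE tpermV tpermL tpermR.
by case: ifP; rewrite ?subrr ?addr0.
Qed.

End Coefficients.

End Garnir.

(** * The dominance statistic *)

Section Dominance.

Variables (la : seq nat) (d : Order.disp_t) (B : finOrderType d).
Local Notation tab := (tab la B).
Local Notation box := (box la).
Implicit Types (t u v w : tab) (s : {perm box}) (D : {set B}).

(* Down-sets, rather than the sets [x <= y] only, so that the numbers of entries
   below and strictly below [y], whose difference is the multiplicity of [y],
   are both available. *)
Definition down_set D : bool :=
  [forall x, forall y, (x <= y)%O && (y \in D) ==> (x \in D)].

Lemma down_setP D :
  reflect (forall x y, (x <= y)%O -> y \in D -> x \in D) (down_set D).
Proof.
apply: (iffP forallP) => [HD x y xy Dy|HD x].
  by move: (HD x) => /forallP/(_ y)/implyP; apply; rewrite xy.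
by apply/forallP => y; apply/implyP => /andP[xy]; exact: HD.
Qed.

Lemma down_le y : down_set [set x | (x <= y)%O]%SET.
Proof. by apply/down_setP => x z xz; rewrite !inE; exact: le_trans. Qed.

Lemma down_lt y : down_set [set x | (x < y)%O]%SET.
Proof. by apply/down_setP => x z xz; rewrite !inE; exact: le_lt_trans. Qed.

Definition cum t k D := #|[set b : box | (brow b < k)%N && (t b \in D)]%SET|.

(** The index [k] counts rows, so it runs up to [size la] included. Summing turns a partial order
    into a number fit for induction. *)
Definition dominance t :=
  (\sum_(p : 'I_(size la).+1 * {set B} | down_set p.2) cum t p.1 p.2)%N.

Lemma cum_row_equiv t u k D : row_equiv t u -> cum t k D = cum u k D.
Proof.
case/row_equivE=> s /RPPP Hs ->; apply/esym.
apply: (card_tact_pred t (P := fun (b : box) z => (brow b < k)%N && (z \in D))).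
by move=> b z; rewrite Hs.
Qed.

Lemma dominance_row_equiv t u : row_equiv t u -> dominance t = dominance u.
Proof. by move=> tu; apply: eq_bigr => p _; exact: cum_row_equiv. Qed.

(** A multiplicity is a double difference: consecutive [k] isolate a row, and the down-sets of
    values at most [y] and below [y] isolate [y]. *)
Lemma cum_eq_row_equiv t u :
  (forall (k : 'I_(size la).+1) D, down_set D -> cum t k D = cum u k D) ->
  row_equiv t u.
Proof.
move=> Htu; pose rcount w (i : 'I_(size la)) D :=
  #|[set b : box | (brow b == i) && (w b \in D)]%SET|.
have cumS w (i : 'I_(size la)) D : cum w i.+1 D = (cum w i D + rcount w i D)%N.
  rewrite /cum -[LHS](cardsID [set b : box | (brow b < i)%N]%SET).
  congr (_ + _)%N; apply: eq_card => b; rewrite !inE ltnS.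
    by rewrite andbAC; case: ltngtP.
  by rewrite -val_eqE /=; case: ltngtP.
have rcount_eq i D : down_set D -> rcount t i D = rcount u i D.
  move=> dD; have Hi : (i < (size la).+1)%N by apply: ltnW; exact: ltn_ord.
  have Hi1 : (i.+1 < (size la).+1)%N by exact: ltn_ord.
  have := Htu (Ordinal Hi1) D dD; rewrite /= !cumS (Htu (Ordinal Hi) D dD) /=.
  exact: addnI.
have rcount_le w i y : rcount w i [set x | (x <= y)%O]%SET =
    (rcount w i [set x | (x < y)%O]%SET + row_count w i y)%N.
  rewrite /rcount -[LHS](cardsID [set b : box | (w b < y)%O]%SET).
  congr (_ + _)%N; apply: eq_card => b; rewrite !inE.
    by rewrite -andbA; case: ltgtP.
  by rewrite andbCA; case: ltgtP; rewrite ?andbF.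
apply/row_equivP => i y; have := rcount_eq i _ (down_le y).
by rewrite !rcount_le rcount_eq ?down_lt // => /addnI.
Qed.

Lemma dominance_lt t u :
  (forall k D, down_set D -> cum t k D <= cum u k D)%N ->
  ~~ row_equiv t u -> (dominance t < dominance u)%N.
Proof.
move=> tu ntu; have := @leqif_sum _ (fun p : 'I_(size la).+1 * {set B} => down_set p.2)
  (fun p => cum t p.1 p.2 == cum u p.1 p.2) (fun p => cum t p.1 p.2)
  (fun p => cum u p.1 p.2).
rewrite -/(dominance t) -/(dominance u) => /(_ _) H.
have {H}[] := H; first by move=> p dp; apply: leqif_eq; exact: tu.
move=> le_tu eq_tu; rewrite ltn_neqAle le_tu eq_tu andbT.
apply: contraNN ntu => /forall_inP Heq; apply: cum_eq_row_equiv => k D dD.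
exact/eqP/(Heq (k, D)).
Qed.

(** [S] meets [L] as little as its size allows: either not at all, or only after covering the rest
    of [X], where inclusion-exclusion applies. *)
Lemma card_setI_min (I : finType) (X L S S' : {set I}) :
  L \subset X -> S' \subset X -> #|S'| = #|S| ->
  [disjoint L & S] || (X \subset L :|: S)%SET -> (#|L :&: S| <= #|L :&: S'|)%N%SET.
Proof.
move=> LX S'X eqS /orP[|XLS].
  by rewrite -setI_eq0 => /eqP->; rewrite cards0.
rewrite -(leq_add2l #|(L :|: S')%SET|) (cardsUI L S') eqS -(cardsUI L S) leq_add2r.
by apply: subset_leq_card; apply: fintype.subset_trans XLS; rewrite finset.subUset LX.
Qed.

Lemma card_setI_max (I : finType) (L S S' : {set I}) : #|S'| = #|S| ->
  (L \subset S) || (S \subset L) -> (#|L :&: S'| <= #|L :&: S|)%N%SET.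
Proof.
move=> eqS /orP[/finset.setIidPl->|/finset.setIidPr->].
  exact/subset_leq_card/subsetIl.
by rewrite -eqS subset_leq_card // subsetIr.
Qed.

(** Only boxes of [X] matter. The two alternatives say that those with entries in [D] avoid the
    first [k] rows, or fill all of [X] outside them, so [card_setI_min] applies. *)
Lemma cum_Sym t X s k D : s \in Sym X ->
  (forall b, b \in X -> (brow b < k)%N -> t b \in D -> False) \/
  (forall b, b \in X -> (brow b < k)%N || (t b \in D)) ->
  (cum t k D <= cum (tact t s) k D)%N.
Proof.
rewrite inE => sX HX; pose u := tact t s.
pose L := [set b | (b \in X) && (brow b < k)%N]%SET.
pose S w := [set b | (b \in X) && (w b \in D)]%SET.
have split_cum w : cum w k D = (#|(L :&: S w)%SET| +
    #|[set b | (b \notin X) && ((brow b < k)%N && (w b \in D))]%SET|)%N.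
  rewrite /cum -[LHS](cardsID X); congr (_ + _)%N; apply: eq_card => b.
    by rewrite !inE; case: (b \in X); rewrite ?andbF ?andbT.
  by rewrite !inE.
rewrite !split_cum; apply: leq_add; last first.
  apply: subset_leq_card; apply/fintype.subsetP => b.
  rewrite !inE => /andP[Xb]; rewrite Xb ffunE.
  by rewrite (out_perm (perm_onV sX)).
apply: (@card_setI_min _ X).
- by apply/fintype.subsetP => b; rewrite inE => /andP[].
- by apply/fintype.subsetP => b; rewrite inE => /andP[].
- apply: (card_tact_pred t (P := fun b z => (b \in X) && (z \in D))) => b z.
  by rewrite perm_closed.
apply/orP; case: HX => HX; [left|right].
  rewrite disjoint_subset; apply/fintype.subsetP => b.
  rewrite !inE => /andP[Xb bk]; rewrite Xb /=; apply/negP.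
  exact: HX.
by apply/fintype.subsetP => b Xb; rewrite !inE Xb HX.
Qed.

(** * Dual Garnir relations at a column violation *)

Section Straightening.

Variables (t : tab) (i i' : 'I_(size la)) (c c' : B).
Hypotheses (ii' : (i < i')%N) (cc' : (c' <= c)%O).

Definition upper_block := [set b : box | (brow b == i) && (c <= t b)%O]%SET.
Definition lower_block := [set b : box | (brow b == i') && (t b <= c')%O]%SET.
Local Notation X := (upper_block :|: lower_block)%SET.

(** The first alternative of [cum_Sym] holds if neither row is among the first [k], or if only the
    upper one is and [c] is not in [D]. The second holds if both are, or if the upper one is and
    [c], hence every entry of the lower block, is in [D]. *)
Lemma cum_Garnir_orbit u k D : u \in Garnir_orbit t upper_block lower_block ->
  down_set D -> (cum t k D <= cum u k D)%N.
Proof.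
case/Garnir_orbitP => s sX -> /down_setP dD; apply: cum_Sym sX _.
have [lt_ik|le_ki] := ltnP i k; last first.
  left=> b; rewrite !inE => /orP[]/andP[/eqP-> _].
    by rewrite ltnNge le_ki.
  by rewrite ltnNge (leq_trans le_ki) // ltnW.
have [Dc|nDc] := boolP (c \in D).
  right=> b; rewrite !inE => /orP[]/andP[/eqP-> tb].
    by rewrite lt_ik.
  by rewrite (dD _ c) ?orbT // (le_trans tb).
have [lt_i'k|le_ki'] := ltnP i' k.
  by right=> b; rewrite !inE => /orP[]/andP[/eqP-> tb]; rewrite ?lt_ik ?lt_i'k.
left=> b; rewrite !inE => /orP[]/andP[/eqP-> tb].
  by move=> _ Dtb; case/negP: nDc; apply: dD Dtb.
by rewrite ltnNge le_ki'.
Qed.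

(* The blocks are cut out of their rows by thresholds on the entries, so the row
   stabiliser of [t] preserves them. *)
Lemma Garnir_coef_sorted : Garnir_coef upper_block lower_block t = 1%N.
Proof.
rewrite /Garnir_coef (_ : (_ :&: _)%SET = rstab t) ?indexgg //.
apply/finset.setIidPl/fintype.subsetP => s /rstabP[Hs ts].
have tb b : t (s b) = t b by rewrite -{1}ts tact_perm.
have /RPPP rb := Hs.
by rewrite RPP_block //; apply/block_permsP; split=> b; rewrite ?rb // !inE rb tb.
Qed.

Lemma box_exists (k : 'I_(size la)) j : (j < nth 0 la k)%N ->
  exists2 b : box, brow b = k & bcol b = j.
Proof.
move=> ltj.
by exists (Tagged (fun i : 'I_(size la) => 'I_(nth 0%N la i)) (Ordinal ltj)).
Qed.

Hypothesis row_sorted : forall b b' : box, brow b = brow b' ->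
  (bcol b <= bcol b')%N -> (t b <= t b')%O.

(** By sortedness the upper block contains its row from the column of [b] rightwards and the lower
    block its row up to that column. The shared column is counted twice, giving one more than the
    row length. *)
Lemma Garnir_blocks_large (b b' : box) : brow b = i -> brow b' = i' ->
  bcol b = bcol b' -> t b = c -> t b' = c' ->
  (nth 0 la i < #|upper_block| + #|lower_block|)%N.
Proof.
move=> bi bi' bb' tb tb'.
have lt_bi : (bcol b < nth 0 la i)%N by rewrite -bi bcol_lt.
have lt_bi' : (bcol b < nth 0 la i')%N by rewrite bb' -bi' bcol_lt.
have large (Y : {set box}) j m :
    {in iota j m, forall k, exists2 b, b \in Y & bcol b = k} -> (m <= #|Y|)%N.
  move=> HY; rewrite -(size_iota j m) cardE -(size_map (@bcol la)).
  apply: uniq_leq_size (iota_uniq _ _) _ => k /HY[b0 Yb0 <-].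
  by apply: map_f; rewrite mem_enum.
rewrite -(subnK (ltnW lt_bi)) -addnS; apply: leq_add.
  apply: (large _ (bcol b)) => k.
  rewrite mem_iota subnKC ?(ltnW lt_bi) // => /andP[bk ki].
  have [b0 b0i b0k] := box_exists ki; exists b0 => //.
  by rewrite inE b0i eqxx -tb row_sorted // ?b0i ?bi // b0k.
apply: (large _ 0%N) => k; rewrite mem_iota add0n ltnS => /andP[_ kb].
have [b0 b0i b0k] := box_exists (leq_ltn_trans kb lt_bi'); exists b0 => //.
by rewrite inE b0i eqxx -tb' row_sorted // ?b0i ?bi' // b0k -bb'.
Qed.

End Straightening.

Lemma row_sort t : exists2 u, row_equiv t u & forall b b' : box,
  brow b = brow b' -> (bcol b <= bcol b')%N -> (u b <= u b')%O.
Proof.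
(* A box supplies the default entry for [nth]. *)
have [b0 _|no_box] := pickP (fun _ : box => true); last first.
  by exists t => [|b]; [exact: row_equiv_refl|have := no_box b].
pose srow i := sort <=%O (codom (row_of t i)).
pose u : tab := [ffun b => nth (t b0) (srow (brow b)) (bcol b)].
have size_srow i : size (srow i) = nth 0%N la i.
  by rewrite size_sort size_codom card_ord.
exists u => [|b b' bb' le_bb'].
  apply/forallP => i; rewrite perm_sym.
  suff -> : codom (row_of u i) = srow i by rewrite perm_sort.
  rewrite /codom /image_mem (eq_map (g := nth (t b0) (srow i) \o val)).
    rewrite map_comp val_enum_ord -(size_srow i).
    exact: mkseq_nth.
  by move=> j; rewrite !ffunE.
rewrite !ffunE bb' (sorted_leq_nth le_trans le_refl) //.
- by apply: sort_sorted; exact: le_total.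
- by rewrite inE size_srow -bb' bcol_lt.
- by rewrite inE size_srow bcol_lt.
Qed.

(** * Column permutations of a column-strict tableau *)

Section Columns.

Variable w : tab.
Hypothesis col_strict : forall b b' : box, bcol b = bcol b' ->
  (brow b < brow b')%N -> (w b < w b')%O.

Lemma col_strict_stab s : s \in col_perms la -> tact w s = w -> s = 1%g.
Proof.
move=> /col_permsP Hs ws; apply/permP => b; rewrite perm1.
have wb : w (s b) = w b by rewrite -{1}ws tact_perm.
have [lt_b|lt_b|eq_b] := ltngtP (brow (s b)) (brow b).
- by have := col_strict (Hs b) lt_b; rewrite wb ltxx.
- by have := col_strict (esym (Hs b)) lt_b; rewrite wb ltxx.
- exact: box_inj (ord_inj eq_b) (Hs b).
Qed.

Let N := (\max_(b : box) bcol b).+1.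

Definition col_cum t (j : 'I_N) k D :=
  #|[set b : box | [&& bcol b == j, (brow b < k)%N & t b \in D]]%SET|.

Lemma cum_col_cum t k D : cum t k D = (\sum_(j < N) col_cum t j k D)%N.
Proof.
have ltN (b : box) : (bcol b < N)%N by rewrite ltnS leq_bigmax.
rewrite /cum -sum1dep_card (partition_big (fun b => Ordinal (ltN b)) predT) //=.
apply: eq_bigr => j _; rewrite sum1dep_card; apply: eq_card => b.
by rewrite !inE -val_eqE /= andbC.
Qed.

(** In one column of [w], the boxes with entries in a down-set and the boxes in the first [k] rows
    are both initial segments, hence comparable, so their intersection is as large as possible. *)
Lemma col_cum_perm s j k D : s \in col_perms la -> down_set D ->
  (col_cum (tact w s) j k D <= col_cum w j k D)%N.
Proof.
move=> /col_permsP Hs /down_setP dD.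
pose L := [set b : box | (bcol b == j) && (brow b < k)%N]%SET.
pose S t := [set b : box | (bcol b == j) && (t b \in D)]%SET.
have colE t : col_cum t j k D = #|(L :&: S t)%SET|.
  by apply: eq_card => b; rewrite !inE; case: (_ == _).
rewrite !colE; apply: card_setI_max.
  apply: (card_tact_pred w (P := fun b z => (bcol b == j :> nat) && (z \in D))) => b z.
  by rewrite Hs.
case: (boolP (_ \subset _)) => //= /subsetPn[b].
rewrite !inE => /andP[/eqP bj bk]; rewrite bj eqxx /= => nDb.
apply/fintype.subsetP => b'; rewrite !inE => /andP[/eqP b'j Db'].
rewrite b'j eqxx /= ltnNge; apply/negP => kb'; case/negP: nDb; apply: dD Db'.
by apply/ltW/col_strict; rewrite ?bj ?b'j // (leq_trans bk).
Qed.

Lemma dominance_col_perm s : s \in col_perms la ->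
  (dominance (tact w s) <= dominance w)%N.
Proof.
move=> Hs; apply: leq_sum => p dp; rewrite !cum_col_cum; apply: leq_sum => j _.
exact: col_cum_perm.
Qed.

(** Equality of the sums forces equality for every column, [k] and down-set. Consecutive [k] isolate
    one box, and down-sets determine its entry, so [s] fixes [w]. *)
Lemma dominance_col_perm_eq s : s \in col_perms la ->
  dominance (tact w s) = dominance w -> s = 1%g.
Proof.
move=> Hs Es; apply: col_strict_stab => //.
have leifE : (dominance (tact w s) <= dominance w ?= iff
    [forall (p : 'I_(size la).+1 * {set B} | down_set p.2),
     [forall j, col_cum (tact w s) j p.1 p.2 == col_cum w j p.1 p.2]])%N.
  apply: leqif_sum => p dp; rewrite !cum_col_cum; apply: leqif_sum => j _.
  exact/leqif_eq/col_cum_perm.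
move: leifE => [_]; rewrite Es eqxx => /esym/forall_inP Hcol.
have mem_eq b D : down_set D -> (tact w s b \in D) = (w b \in D).
  move=> dD; have ltN : (bcol b < N)%N by rewrite ltnS leq_bigmax.
  have Hi : (brow b < (size la).+1)%N by apply: ltnW; exact: ltn_ord.
  have Hi1 : ((brow b).+1 < (size la).+1)%N by exact: ltn_ord.
  have /forallP/(_ (Ordinal ltN))/eqP/= := Hcol (Ordinal Hi, D) dD.
  have /forallP/(_ (Ordinal ltN))/eqP/= := Hcol (Ordinal Hi1, D) dD.
  have colS t : col_cum t (Ordinal ltN) (brow b).+1 D =
      (col_cum t (Ordinal ltN) (brow b) D + (t b \in D))%N.
    rewrite /col_cum -[LHS](cardsID [set b' : box | (brow b' < brow b)%N]%SET).
    congr (_ + _)%N.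
      by apply: eq_card => b'; rewrite !inE ltnS; case: ltngtP; rewrite ?andbF ?andbT.
    rewrite (_ : (_ :\: _)%SET = [set b' | (b' == b) && (t b \in D)]%SET).
      case: (t b \in D); apply/eqP;
        [apply/cards1P; exists b|rewrite cards_eq0; apply/eqP];
        by apply/setP => b'; rewrite !inE ?andbT ?andbF.
    apply/setP => b'; rewrite !inE ltnS -leqNgt.
    apply/and4P/andP => [[bb /eqP cb bb' Db]|[/eqP-> ->]]; last by rewrite leqnn eqxx.
    have <- : b' = b by apply: box_inj cb; apply/ord_inj/eqP; rewrite eqn_leq bb bb'.
    by rewrite eqxx.
  rewrite !colS /= => + eq_cum; rewrite eq_cum => /addnI.
  by case: (_ \in D); case: (_ \in D).
apply/ffunP => b; apply/le_anti/andP; split.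
  by have := mem_eq b _ (down_le (w b)); rewrite !inE lexx => ->.
by have := mem_eq b _ (down_le (tact w s b)); rewrite !inE lexx => <-.
Qed.

End Columns.
End Dominance.

(** * Straightening and independence *)

Section Semistandard.

Variables (la : seq nat) (d : Order.disp_t) (B : finOrderType d).
Local Notation tab := (tab la B).
Local Notation box := (box la).
Implicit Types (t u v w : tab).

Lemma semistandardP t : reflect
  ((forall b b' : box, brow b = brow b' -> (bcol b <= bcol b')%N -> (t b <= t b')%O) /\
   (forall b b' : box, bcol b = bcol b' -> (brow b < brow b')%N -> (t b < t b')%O))
  (semistandard t).
Proof.
apply: (iffP forallP) => [Ht|[Hrow Hcol] b].
  split=> b b' /eqP eq_bb' lt_bb';
    have /forallP/(_ b')/andP[/implyP Hr /implyP Hc] := Ht b.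
    by apply: Hr; rewrite eq_bb'.
  by apply: Hc; rewrite eq_bb'.
apply/forallP => b'; apply/andP; split; apply/implyP => /andP[/eqP eq_bb' lt_bb'].
  exact: Hrow.
exact: Hcol.
Qed.

Lemma row_equiv_sorted t u :
  (forall b b' : box, brow b = brow b' -> (bcol b <= bcol b')%N -> (t b <= t b')%O) ->
  (forall b b' : box, brow b = brow b' -> (bcol b <= bcol b')%N -> (u b <= u b')%O) ->
  row_equiv t u -> t = u.
Proof.
move=> sorted_t sorted_u /forallP tu.
have sorted_row w i :
    (forall b b' : box, brow b = brow b' -> (bcol b <= bcol b')%N -> (w b <= w b')%O) ->
    sorted <=%O (codom (row_of w i)).
  move=> sorted_w.
  apply: (homo_sorted (e := fun j j' : 'I_(nth 0%N la i) => (j < j')%N)).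
    by move=> j j' lt_jj'; rewrite !ffunE; apply: sorted_w => //; exact: ltnW.
  by have := iota_ltn_sorted 0 (nth 0%N la i); rewrite -val_enum_ord sorted_map.
apply/ffunP => -[i j].
have /eq_in_map/(_ j) : codom (row_of t i) = codom (row_of u i).
  by apply: (sorted_eq le_trans le_anti) (tu i); exact: sorted_row.
by rewrite !ffunE => -> //; rewrite mem_enum.
Qed.

Section Alternation.

Variable R : comPzRingType.
Variables w : tab.
Hypothesis ss_w : semistandard w.

Let col_w : forall b b' : box, bcol b = bcol b' ->
  (brow b < brow b')%N -> (w b < w b')%O.
Proof. by have /semistandardP[] := ss_w. Qed.

Lemma alt_rsym_diag : alt w (rsym R w) = 1.
Proof.
have one_col : 1%g \in col_perms la by apply/col_permsP => b; rewrite perm1.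
rewrite /alt (bigD1 _ one_col) /= odd_perm1 expr0 mul1r tact1 rsymE row_equiv_refl.
rewrite big1 ?addr0 // => s /andP[Hs /eqP ne_s1]; rewrite rsymE.
case: (boolP (row_equiv _ _)) => [ww|_]; last by rewrite mulr0.
case: ne_s1; apply: (dominance_col_perm_eq col_w Hs).
by rewrite (dominance_row_equiv ww).
Qed.

(** A nonzero term needs [t] row equivalent to [w.s], which squeezes the dominance of [w.s] to that
    of [w]. Then [s = 1], and [t] and [w], both row-sorted, coincide. *)
Lemma alt_rsym_triangular t : semistandard t -> t != w ->
  (dominance w <= dominance t)%N -> alt w (rsym R t) = 0.
Proof.
move=> ss_t /eqP ne_tw le_wt; rewrite /alt big1 // => s Hs; rewrite rsymE.
case: (boolP (row_equiv _ _)) => [tws|_]; last by rewrite mulr0.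
have dom_eq : dominance (tact w s) = dominance w.
  apply/eqP; rewrite eqn_leq dominance_col_perm //=.
  by rewrite -(dominance_row_equiv tws).
have s1 := dominance_col_perm_eq col_w Hs dom_eq.
case: ne_tw; move: tws; rewrite s1 tact1.
apply: row_equiv_sorted; first by have /semistandardP[] := ss_t.
by have /semistandardP[] := ss_w.
Qed.

End Alternation.

Section Straightening.

Variable R : comPzRingType.
Local Notation tensor := (tens R B box).
Local Notation rsym_ss := (fun s : SSYT la B => rsym R (val s)).

Definition straightens (z : tensor) : Prop :=
  exists c, DG la B R (z - lincomb rsym_ss c).

Lemma straightens_DG z : DG la B R z -> straightens z.
Proof.
exists [ffun _ => 0]; rewrite /lincomb big1 ?subr0 // => s _.
by rewrite ffunE scale0r.
Qed.

Lemma straightens_lin a x y :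
  straightens x -> straightens y -> straightens (a *: x + y).
Proof.
move=> [c Hc] [c' Hc']; exists [ffun s => a * c s + c' s].
rewrite (_ : _ - _ = a *: (x - lincomb rsym_ss c) + (y - lincomb rsym_ss c')).
  exact: rspan_lin.
rewrite scalerBr addrACA -opprD; congr (_ - _).
rewrite /lincomb scaler_sumr -big_split; apply: eq_bigr => s _ /=.
by rewrite ffunE scalerDl scalerA.
Qed.

Lemma straightens_sum (I : Type) (r : seq I) (Q : pred I) (a : I -> R)
    (f : I -> tensor) :
  (forall i, Q i -> straightens (f i)) -> straightens (\sum_(i <- r | Q i) a i *: f i).
Proof.
move=> Hf; elim/big_rec: _ => [|i y Qi Hy]; first exact/straightens_DG/rspan0.
by apply: straightens_lin => //; exact: Hf.
Qed.

Lemma straightens_ss (s : SSYT la B) : straightens (rsym R (val s)).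
Proof.
exists [ffun s' => (s' == s)%:R]; rewrite /lincomb (bigD1 s) //= ffunE eqxx scale1r.
rewrite big1 ?addr0 ?subrr; first exact: rspan0.
by move=> s' /negPf ne_s's; rewrite ffunE ne_s's scale0r.
Qed.

Lemma straightens_rsym t : straightens (rsym R t).
Proof.
pose bound := (\sum_(p : 'I_(size la).+1 * {set B} | down_set p.2) #|{: box}|)%N.
have dom_bound u : (dominance u <= bound)%N.
  by apply: leq_sum => p _; exact: max_card.
(* Induction from high dominance downwards; [bound] replaces every count by the number of boxes. *)
have [m] := ubnP (bound - dominance t)%N; elim: m t => // m IHm t lt_tm.
have [u tu row_u] := row_sort t.
rewrite (eq_rsym R tu); rewrite (dominance_row_equiv tu) in lt_tm.
have [ss_u|/semistandardP nss_u] := boolP (semistandard u).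
  exact: (straightens_ss (Sub u ss_u)).
have [b [b' [eq_bb' lt_bb' le_u]]] : exists b b' : box,
    [/\ bcol b = bcol b', (brow b < brow b')%N & (u b' <= u b)%O].
  apply: contrapT => nob; case: nss_u; split=> // b b' eq_bb' lt_bb'.
  by rewrite ltNge; apply/negP => le_u; case: nob; exists b, b'.
pose A := upper_block u (brow b) (u b); pose C := lower_block u (brow b') (u b').
have u_orbit : u \in Garnir_orbit u A C.
  by apply/Garnir_orbitP; exists 1%g; rewrite ?group1 ?tact1.
(* The chosen representative of the class of [u] may differ from [u]. Its coefficient is still 1,
   since both coefficients count the same cosets for [u]. *)
have [u0 Xu0 u0u] := row_repsP u_orbit.
have coef_u0 : Garnir_coef A C u0 = 1%N.
  have /row_equivE[r Hr Eu] := u0u.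
  rewrite -(Garnir_coef_count (row_reps_sub Xu0) Hr) -Eu.
  have := Garnir_coef_count u_orbit (group1 _); rewrite tact1 => ->.
  exact: Garnir_coef_sorted.
have := dual_GarnirE u A C R; rewrite (bigD1 u0) //= coef_u0 scale1r.
rewrite (eq_rsym R u0u) => /esym/(canRL (addrK _)) ->.
rewrite -scaleN1r -[dual_Garnir _ _ _ _]scale1r.
apply: straightens_lin.
  apply/straightens_DG/rspan_gen; exists u, (brow b), (brow b'), A, C; split=> //.
  - by apply/fintype.subsetP => x; rewrite !inE => /andP[].
  - by apply/fintype.subsetP => x; rewrite !inE => /andP[].
  - exact: (Garnir_blocks_large row_u).
rewrite -[_ *: _]addr0; apply: straightens_lin; last exact/straightens_DG/rspan0.
apply: straightens_sum => v /andP[Xv ne_vu0]; apply: IHm.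
have Tv := row_reps_sub Xv.
(* Strict, because another representative cannot be row equivalent to [u]. *)
have lt_uv : (dominance u < dominance v)%N.
  apply: dominance_lt => [k D|]; first exact: (cum_Garnir_orbit lt_bb' le_u _ Tv).
  apply: contraNN ne_vu0 => uv; apply/eqP; apply: (row_reps_inj Xv Xu0).
  by rewrite row_equiv_sym; exact: row_equiv_trans u0u uv.
apply: leq_trans (ltnSE lt_tm); apply: (ltn_sub2l _ lt_uv).
exact: leq_trans lt_uv (dom_bound v).
Qed.

Lemma straightens_Sym z : Symlambda la B R z -> straightens z.
Proof.
move=> /SymlambdaP/row_invariant_sum->; apply: straightens_sum => v _.
exact: straightens_rsym.
Qed.

Lemma DG_Sym z : DG la B R z -> Symlambda la B R z.
Proof.
move: z; apply: rspan_ind => [|a x y [t [i [i' [A [C [_ _ _ _ ->]]]]]] Hy].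
  exact: rspan0.
apply: rspan_lin => //; rewrite dual_GarnirE; apply: rspan_sum => u _.
by apply: rspanZ; exact: rsym_Symlambda.
Qed.

Variables (V : lmodType R) (e : B -> V).
Hypothesis e_basis : is_basis (fun _ : V => True) e.
Variable n : nat.
Hypothesis la_part : is_part n la.

Lemma to_ext_DG z : DG la B R z -> to_ext e z = 0.
Proof.
move: z; apply: rspan_ind => [|a x y [t [i [i' [A [C [ii' sA sC lt ->]]]]]] Hy].
  exact: linear0.
rewrite linearP /= Hy (to_ext_dual_Garnir _ ii' sA sC e_basis la_part) //.
by rewrite scaler0 addr0.
Qed.

Lemma to_ext_lincomb c : to_ext e (lincomb rsym_ss c) =
  lincomb (fun s : SSYT la B => copolytabloid e (val s)) c.
Proof.
by rewrite linear_sum; apply: eq_bigr => s _; rewrite linearZ /= to_ext_rsym.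
Qed.

(** Apply [alt] at [s]: terms of smaller dominance have zero coefficient by induction, and the other
    terms except [s] vanish by triangularity. *)
Lemma copolytabloid_free c :
  lincomb (fun s : SSYT la B => copolytabloid e (val s)) c = 0 -> forall s, c s = 0.
Proof.
rewrite -to_ext_lincomb => /to_ext0 Hc s.
have [m] := ubnP (dominance (val s)); elim: m s => // m IHm s lt_sm.
have := alt_col_repeat (val s) Hc; rewrite /lincomb alt_sum.
rewrite (bigD1 s) //= (alt_rsym_diag R (valP s)) mulr1 big1 ?addr0 // => s' ne_s's.
have [lt_s's|le_ss'] := ltnP (dominance (val s')) (dominance (val s)).
  by rewrite IHm ?mul0r // (leq_trans lt_s's).
by rewrite (alt_rsym_triangular R (valP s) (valP s')) ?mulr0.
Qed.

(** Straighten [z] modulo [DG]; if its image is zero, freeness of the semistandard copolytabloids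
    kills every remaining coefficient. *)
Lemma DG_kernel z : Symlambda la B R z -> (to_ext e z = 0 <-> DG la B R z).
Proof.
move=> Sz; split=> [z0|]; last exact: to_ext_DG.
have [c Hc] := straightens_Sym Sz.
have c0 : forall s, c s = 0.
  apply: copolytabloid_free; rewrite -to_ext_lincomb; apply/eqP.
  by rewrite -oppr_eq0 -[X in X == _]add0r -{1}z0 -linearB /= to_ext_DG.
by move: Hc; rewrite /lincomb big1 ?subr0 // => s _; rewrite c0 scale0r.
Qed.

Lemma copolytab_image z : Symlambda la B R z -> copolytab la e (to_ext e z).
Proof.
move=> /SymlambdaP/row_invariant_sum->; rewrite linear_sum; apply: rspan_sum => t _.
by rewrite linearZ /= to_ext_rsym; apply/rspanZ/rspan_gen; exists t.
Qed.

Lemma copolytab_preimage q : copolytab la e q ->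
  exists2 z, Symlambda la B R z & to_ext e z = q.
Proof.
move: q; apply: rspan_ind => [|a _ y [t ->] [z Sz <-]].
  by exists 0; [exact: rspan0|exact: linear0].
exists (a *: rsym R t + z); last by rewrite linearP /= to_ext_rsym.
by apply: rspan_lin => //; exact: rsym_Symlambda.
Qed.

Lemma copolytab_basis :
  is_basis (copolytab la e) (fun s : SSYT la B => copolytabloid e (val s)).
Proof.
split=> [q|]; last exact: copolytabloid_free.
split=> [/copolytab_preimage[z Sz <-]|[c ->]].
  have [c Hc] := straightens_Sym Sz; exists c; rewrite -to_ext_lincomb.
  by apply/eqP; rewrite -subr_eq0 -linearB /= to_ext_DG.
apply: rspan_sum => s _; apply/rspanZ/rspan_gen.
by exists (val s).
Qed.

Lemma Symlambda_exact (G : groupType) (rho : G -> V -> V) : representation rho ->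
  short_exact (tens_act e rho) (ext_act e rho)
    (DG la B R) (Symlambda la B R) (to_ext e) (copolytab la e).
Proof.
move=> rho_rep; split.
- exact: tens_rep.
- exact: ext_rep.
- split=> [|a x y|g z DGz]; [exact: rspan0|exact: rspan_lin|].
  (* [DG] is stable under [G] as the kernel of an equivariant map on [Symlambda]; no relation is
     acted on explicitly. *)
  apply/DG_kernel; first by apply/(tens_act_Sym e)/DG_Sym.
  rewrite -ext_actE // to_ext_DG // -(linear0 (to_ext e)) ext_actE //.
  by rewrite !linear0.
- split=> [|a x y|g z]; [exact: rspan0|exact: rspan_lin|exact: tens_act_Sym].
- split=> [|a x y|g q]; [exact: rspan0|exact: rspan_lin|].
  case/copolytab_preimage=> z Sz <-; rewrite ext_actE //.
  by apply: copolytab_image; exact: tens_act_Sym.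
- exact: DG_Sym.
- exact: copolytab_image.
- by move=> a x y _ _; rewrite linearP.
- by move=> g x _; rewrite ext_actE.
- exact: DG_kernel.
- exact: copolytab_preimage.
Qed.

End Straightening.
End Semistandard.

Theorem theorem1p2 (G : groupType) (R : comPzRingType) (V : lmodType R)
    (rho : G -> V -> V) (rho_rep : representation rho)
    (n : nat) (la : seq nat) (la_part : is_part n la)
    (d : Order.disp_t) (B : finOrderType d) (e : B -> V)
    (e_basis : is_basis (fun _ : V => True) e) :
  (short_exact (tens_act e rho) (ext_act e rho)
     (DG la B R) (Symlambda la B R) (to_ext e) (copolytab la e)
   /\ forall t : tab la B,
        Symlambda la B R (rsym R t) /\ to_ext e (rsym R t) = copolytabloid e t)
  /\ is_basis (copolytab la e) (fun s : SSYT la B => copolytabloid e (val s)).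
Proof.
split; last exact: (copolytab_basis e_basis la_part).
split; first exact: (Symlambda_exact e_basis la_part rho_rep).
by move=> t; split; [exact: rsym_Symlambda|exact: to_ext_rsym].
Qed.
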